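(* Let $G$ be a planar graph in which no $4$-cycle is adjacent to a $3$-cycle. Let $s\geq 2$ be an integer and let $f_1,\ldots,f_s$ be functions on $V(G)$ such that $f_i(v)\in\{0,1,2\}$ for each $v\in V(G)$ and each $i\in\{1,\ldots,s\}$, and $f_1(v)+\cdots+f_s(v)\geq 4$ for each $v\in V(G)$. Then $G$ is DP-$(f_1,\ldots,f_s)$-colorable.
   Context: All graphs are finite, simple and undirected. Two cycles are adjacent if they share at least one edge. For a function $f$ from $V(G)$ to the nonnegative integers, a graph $G$ is strictly $f$-degenerate if every (nonempty) subgraph $G'$ of $G$ has a vertex $v$ with $d_{G'}(v)<f(v)$. (In particular, if $G$ is strictly $f$-degenerate then $f(v)\geq 1$ for every $v\in V(G)$.) A cover $H$ of $G$ with the list $\{1,\ldots,s\}$ for every vertex is a graph such that: (i) $V(H)=V(G)\times\{1,\ldots,s\}$; (ii) for each $u\in V(G)$, the induced subgraph $H[\{u\}\times\{1,\ldots,s\}]$ is complete; (iii) for each edge $uv\in E(G)$, the set of edges of $H$ with one endpoint in $\{u\}\times\{1,\ldots,s\}$ and the other in $\{v\}\times\{1,\ldots,s\}$ is a matching (possibly empty); (iv) if $u\neq v$ and $uv\notin E(G)$, then no edge of $H$ joins $\{u\}\times\{1,\ldots,s\}$ and $\{v\}\times\{1,\ldots,s\}$. A representative set $R$ of $G$ is a set of vertices of $H$ such that $|R|=|V(G)|$ and $u\neq v$ for any two different members $(u,c)$ and $(v,c')$ of $R$ (so $R$ contains exactly one vertex $(v,c)$ for each $v\in V(G)$). The representative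 graph $G_R$ has vertex set $V(G)$, and $u,v$ are adjacent in $G_R$ if and only if there are $(u,i),(v,j)\in R$ (with $u\ne v$) that are adjacent in $H$. Define $f_R(v)=f_i(v)$ where $(v,i)\in R$. $G$ is DP-$(f_1,\ldots,f_s)$-colorable if for every cover $H$ of $G$ with the list $\{1,\ldots,s\}$ for every vertex there is a representative set $R$ such that $G_R$ is strictly $f_R$-degenerate. *)

(* Defs.v *)
From mathcomp Require Import all_boot all_fingroup.

Set Implicit Arguments.
Unset Strict Implicit.
Unset Printing Implicit Defensive.

Record sgraph (V : finType) := SGraph {
  adj :> rel V;
  adj_sym : symmetric adj;
  adj_irr : irreflexive adj }.

Section Graph.
Variables (V : finType) (G : sgraph V).

Definition degree (v : V) : nat := #|[set w | G v w]|.

(* A subgraph is given by its vertex set A and its adjacency relation G', a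
   graph on the ambient type V all of whose edges have both ends in A. *)
Definition is_subgraph (A : {set V}) (G' : sgraph V) : Prop :=
  forall u v, G' u v -> [/\ u \in A, v \in A & G u v].

(* A k-cycle is the sequence of its k vertices, in cyclic order. *)
Definition is_cycle (k : nat) (c : seq V) : bool :=
  [&& 3 <= k, size c == k, path.cycle G c & uniq c].

Definition cycle_edge (c : seq V) (u v : V) : bool :=
  (u \in c) && ((next c u == v) || (prev c u == v)).

Definition adjacent_cycles (c c' : seq V) : Prop :=
  exists u v, cycle_edge c u v /\ cycle_edge c' u v.

(* Planarity is expressed by combinatorial maps. Each edge {u, v} yields the
   two darts (u, v) and (v, u). An embedding into an oriented closed surface is
   encoded by the cyclic order of the darts leaving each vertex; the boundary
   walks of its faces are then the orbits of d |-> rot (rev d). *)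
Definition dart := {d : V * V | G d.1 d.2}.

Definition dart_src (d : dart) : V := (val d).1.

Lemma rev_dart_subproof (d : dart) : G (val d).2 (val d).1.
Proof. by rewrite adj_sym (valP d). Qed.

Definition rev_dart (d : dart) : dart :=
  exist (fun d : V * V => G d.1 d.2) ((val d).2, (val d).1)
    (rev_dart_subproof d).

Lemma rev_dart_inj : injective rev_dart.
Proof.
by move=> [[u v] uv] [[u' v'] uv'] [ev eu]; apply: val_inj; rewrite /= eu ev.
Qed.

Definition rotation_system (rot : {perm dart}) : Prop :=
  forall d d', (d' \in porbit rot d) = (dart_src d' == dart_src d).

Definition face_perm (rot : {perm dart}) : {perm dart} :=
  (perm rev_dart_inj * rot)%g.

Definition non_isolated : {set V} := [set v | [exists w, G v w]].

(* A connected component with at least one edge, embedded with genus g, has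
   (vertices) + (faces) = (edges) + 2 - 2g. Summing over these components, the
   equality below says that all of them are embedded in the sphere. Isolated
   vertices carry no dart and are left out. *)
Definition planar : Prop :=
  exists2 rot : {perm dart}, rotation_system rot &
    #|non_isolated| + #|porbits (face_perm rot)|
      = #|{: dart}|./2 + 2 * n_comp G non_isolated.

End Graph.

Definition strictly_degenerate (V : finType) (G : sgraph V) (f : V -> nat) :
    Prop :=
  forall (A : {set V}) (G' : sgraph V), is_subgraph G A G' -> A != set0 ->
    exists2 v, v \in A & degree G' v < f v.

Section DPColoring.
Variables (V : finType) (G : sgraph V) (s : nat).

(* The list {1, ..., s} is represented by 'I_s = {0, ..., s - 1}. *)
Definition is_cover (H : sgraph (V * 'I_s)%type) : Prop :=
  [/\ forall u i j, i != j -> H (u, i) (u, j),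
      forall u v, G u v -> forall i j i' j',
        H (u, i) (v, j) -> H (u, i') (v, j') -> (i = i' <-> j = j')
    & forall u v, u != v -> ~~ G u v -> forall i j, ~~ H (u, i) (v, j)].

Definition representative_set (R : {set V * 'I_s}) : Prop :=
  #|R| = #|V| /\
  {in R &, forall x y : V * 'I_s, x != y -> x.1 != y.1}.

Section Representative.
Variables (H : sgraph (V * 'I_s)%type) (R : {set V * 'I_s}).

Definition rep_adj : rel V := fun u v =>
  (u != v) &&
  [exists i, exists j, [&& (u, i) \in R, (v, j) \in R & H (u, i) (v, j)]].

Lemma rep_adj_sym : symmetric rep_adj.
Proof.
suff imp u v : rep_adj u v -> rep_adj v u by move=> u v; apply/idP/idP; apply: imp.
case/andP=> uv /existsP[i /existsP[j /and3P[Ri Rj Hij]]].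
rewrite /rep_adj eq_sym uv; apply/existsP; exists j; apply/existsP; exists i.
by rewrite Ri Rj adj_sym Hij.
Qed.

Lemma rep_adj_irr : irreflexive rep_adj.
Proof. by move=> u; rewrite /rep_adj eqxx. Qed.

Definition rep_graph : sgraph V := SGraph rep_adj_sym rep_adj_irr.

(* For a representative set R, the index i with (v, i) \in R exists and is
   unique; the default value 0 is never used. *)
Definition rep_fun (f : 'I_s -> V -> nat) (v : V) : nat :=
  if [pick i | (v, i) \in R] is Some i then f i v else 0.

End Representative.

Definition DP_colorable (f : 'I_s -> V -> nat) : Prop :=
  forall H : sgraph (V * 'I_s)%type, is_cover H ->
    exists2 R : {set V * 'I_s}, representative_set R &
      strictly_degenerate (rep_graph H R) (rep_fun R f).

End DPColoring.

(* Main.v *)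
Require Import Defs.
From Stdlib Require Import Classical.
From mathcomp Require Import all_boot all_fingroup zify.

(** Colour the vertices one after the other, so that each of them conflicts with
    fewer earlier vertices than the value of its colour; a subgraph then has its
    latest vertex as a witness of strict degeneracy ([colouring_rep]). A coloured
    vertex takes away at most one unit of value from each of its neighbours, and
    every vertex has a total value of at least 4, so a vertex of degree at most 3
    can always be left to the end. The same holds for a house of 4-vertices: a
    5-cycle and a vertex [t] adjacent to two consecutive vertices [u1], [u2] of
    it, all of degree 4. Such a house is induced ([house_is_hollow]), its vertices
    keep a total value of at least 2, and of at least 3 for [u1] and [u2], and
    since no colour has a value above 2, it can be coloured ([colour_house]).

    It remains to see that a plane graph with all degrees at least 4, in which no
    4-cycle is adjacent to a triangle, contains a house of 4-vertices
    ([euler_deficit]). Give each vertex the charge degree - 4 and each face the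
    charge size - 4; the sum is negative by Euler's formula. Only triangles are
    negative, and they get 1/3 from each of the three faces around them, which
    have size at least 5. That suffices but for 5-faces next to four or five
    triangles. These are paid by their vertices of degree at least 5. If a 5-face
    has none, then the triangles next to it have an apex of degree at least 5, or
    there is a house of 4-vertices, and it is the apex that pays. The vertices can
    afford this: where one would pay too much, degrees of 4 around it again force
    a house ([send_pay_next], [send_pay_prev]) or two adjacent triangles
    ([pay_both]).

    Planarity is used for subgraphs. Euler's inequality
    (vertices) + (faces) >= (edges) + 2 (components) is all that discharging
    needs, and it is inherited when an edge is deleted from a rotation system
    ([spherical_delete]). *)

Set Implicit Arguments.
Unset Strict Implicit.
Unset Printing Implicit Defensive.

(** * Orbits of permutations *)

Section Orbits.
Variable T : finType.
Implicit Types (s : {perm T}) (x y z : T).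

Lemma porbit_iter s x y :
  y \in porbit s x -> exists2 i, i < #|porbit s x| & y = iter i s x.
Proof. by rewrite porbit_traject => /trajectP[i]; exists i. Qed.

Lemma iter_in_porbit s x i : iter i s x \in porbit s x.
Proof. by rewrite -permX mem_porbit. Qed.

Lemma porbit_next s x y : (s y \in porbit s x) = (y \in porbit s x).
Proof.
rewrite -!eq_porbit_mem; congr (_ == _).
by have := porbit_perm s 1 y; rewrite expg1.
Qed.

Lemma porbit_eqP s x y : reflect (porbit s x = porbit s y) (x \in porbit s y).
Proof. by rewrite -eq_porbit_mem; apply: eqP. Qed.

Lemma porbit_ind s x (P : T -> Prop) :
  P x -> (forall z, P z -> P (s z)) -> {in porbit s x, forall y, P y}.
Proof.
move=> Px Ps y /porbit_iter[i _ ->].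
by elim: i => //= i; apply: Ps.
Qed.

Lemma porbit_fixed s x : s x = x -> porbit s x = [set x].
Proof.
move=> sx; apply/setP=> y; rewrite inE; apply/idP/eqP=> [|->]; last exact: porbit_id.
by move: y; apply: porbit_ind => // z ->.
Qed.

Lemma big_porbit s x (F : T -> nat) :
  \sum_(y in porbit s x) F y = \sum_(i < #|porbit s x|) F (iter i s x).
Proof.
rewrite (eq_bigl _ _ (porbit_traject s x)) -(big_uniq _ (uniq_traject_porbit s x)) /=.
rewrite (big_nth x) size_traject big_mkord; apply: eq_bigr => i _.
by rewrite nth_traject.
Qed.

Lemma sum_porbit_next s x (F : T -> nat) :
  \sum_(y in porbit s x) F (s y) = \sum_(y in porbit s x) F y.
Proof.
rewrite [RHS](reindex_inj (@perm_inj _ s)).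
by apply: eq_bigl => y; rewrite porbit_next.
Qed.

Lemma card_porbits_tperm s x y :
  #|porbits (tperm x y * s)| + (x \notin porbit s y).*2
    = #|porbits s| + (x != y).
Proof. exact: porbits_mul_tperm. Qed.

(** Cutting [x] out of its orbit: the predecessor of [x] is sent to the
    successor of [x], and [x] becomes fixed. *)
Definition bypass s x : {perm T} := (s * tperm x (s x))%g.

Lemma bypassE s x z :
  bypass s x z = if z == x then x else if s z == x then s x else s z.
Proof.
rewrite permM; case: (z =P x) => [->|zx]; first by rewrite tpermR.
have sz : s z != s x by rewrite (inj_eq perm_inj); apply/eqP.
case: (s z =P x) => [->|szx]; first by rewrite tpermL.
by rewrite tpermD // eq_sym //; apply/eqP.
Qed.

Lemma card_porbits_bypass s x :
  #|porbits (bypass s x)| = #|porbits s| + (s x != x).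
Proof.
rewrite -porbitsV /bypass invMg tpermV.
have := card_porbits_tperm s^-1%g x (s x); rewrite porbitV.
have -> : x \in porbit s (s x) by rewrite porbit_sym porbit_next porbit_id.
by rewrite porbitsV addn0 [x == _]eq_sym.
Qed.

Lemma porbit_bypass s x z :
  z != x -> porbit (bypass s x) z = porbit s z :\ x.
Proof.
move=> zx; apply/setP=> y; rewrite !inE; apply/idP/andP.
  move=> yz; move: y yz.
  apply: porbit_ind => [|y [yx yz]]; first by rewrite porbit_id.
  rewrite bypassE (negPf yx); have [syx|syx] := eqVneq (s y) x.
    split; last by rewrite porbit_next -syx porbit_next.
    apply: contraNneq yx => sx; rewrite -(inj_eq (@perm_inj _ s)) sx syx //.
  by rewrite porbit_next.
case=> yx /porbit_iter[i _ Ey].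
elim/ltn_ind: i y Ey yx => -[|i] IH y Ey yx; first by rewrite Ey porbit_id.
have [ex|nex] := eqVneq (iter i s z) x; last first.
  have := IH i (ltnSn _) _ erefl nex.
  by rewrite -porbit_next bypassE (negPf nex) -iterS -Ey (negPf yx).
case: i => [|i] in IH Ey ex; first by rewrite -ex eqxx in zx.
have nez : iter i s z != x.
  apply: contraNneq yx => ez.
  by rewrite Ey [iter _ _ _]/= -[s (iter i s z)]/(iter i.+1 s z) ex -{1}ez
             -[s (iter i s z)]/(iter i.+1 s z) ex.
have := IH i (leqnSn _) _ erefl nez.
rewrite -porbit_next bypassE (negPf nez) -[s (iter i s z)]/(iter i.+1 s z) ex.
by rewrite eqxx -{1}ex -[s (iter _ s z)]/(iter i.+2 s z) -Ey.
Qed.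

(** Outside [D] every orbit is a singleton, so that orbits never straddle [D]. *)
Lemma card_porbits_split s (D : {set T}) :
  (forall x, x \notin D -> s x = x) ->
  #|porbits s| = #|porbit s @: D| + #|~: D|.
Proof.
move=> fixD.
have -> : porbits s = porbit s @: D :|: porbit s @: ~: D.
  rewrite -imsetU setUCr; apply/setP=> O.
  by apply/imsetP/imsetP=> -[x _ ->]; exists x.
rewrite cardsU [#|porbit s @: ~: D|]card_in_imset; last first.
  move=> x y; rewrite !inE => /fixD fx /fixD fy.
  by rewrite !porbit_fixed // => /set1_inj.
suff -> : porbit s @: D :&: porbit s @: (~: D) = set0 by rewrite cards0 subn0.
apply/setP=> O; rewrite !inE; apply/andP=> -[/imsetP[x xD ->]] /imsetP[y].
rewrite inE => yD /eqP; rewrite eq_porbit_mem porbit_fixed ?fixD // inE => /eqP exy.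
by rewrite -exy xD in yD.
Qed.

Lemma stable_porbit s (D : {set T}) x y :
  (forall z, (s z \in D) = (z \in D)) -> y \in porbit s x -> (y \in D) = (x \in D).
Proof. by move=> sD; move: y; apply: porbit_ind => // z <-. Qed.

Lemma fixed_stable s (D : {set T}) :
  (forall x, x \notin D -> s x = x) -> forall z, (s z \in D) = (z \in D).
Proof.
move=> fixD z; case zD: (z \in D); last by rewrite fixD ?zD.
by apply/negPn/negP=> szD; have /fixD/perm_inj sz := szD; rewrite sz zD in szD.
Qed.

Lemma sum_porbits s (D : {set T}) (F : T -> nat) :
  (forall z, (s z \in D) = (z \in D)) ->
  \sum_(x in D) F x = \sum_(O in porbit s @: D) \sum_(x in O) F x.
Proof.
move=> sD; rewrite (partition_big_imset (porbit s)) /=.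
apply: eq_bigr => _ /imsetP[x xD ->]; apply: eq_bigl => y.
rewrite eq_porbit_mem andb_idl // => yx.
by rewrite (stable_porbit sD yx).
Qed.

Lemma sum_stable s (D : {set T}) (F : T -> nat) :
  (forall z, (s z \in D) = (z \in D)) ->
  \sum_(x in D) F (s x) = \sum_(x in D) F x.
Proof.
move=> sD; rewrite [RHS](reindex_inj (@perm_inj _ s)).
by apply: eq_bigl => y; rewrite sD.
Qed.

End Orbits.

(** Passing from a permutation of a subtype to its extension by the identity. *)
Lemma card_porbits_sub (T : finType) (P : pred T) (sT : subFinType P)
    (s : {perm T}) (t : {perm sT}) :
  (forall x, s (val x) = val (t x)) ->
  #|porbit s @: [set x | P x]| = #|porbits t|.
Proof.
move=> st.
have iter_st x i : iter i s (val x) = val (iter i t x) by elim: i => //= i ->.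
have mem_st x y : (val y \in porbit s (val x)) = (y \in porbit t x).
  apply/idP/idP=> /porbit_iter[i _]; last by move=> ->; rewrite -iter_st iter_in_porbit.
  by rewrite iter_st => /val_inj ->; apply: iter_in_porbit.
have -> : porbit s @: [set x | P x] = (fun O : {set sT} => [set val x | x in O]) @: porbits t.
  rewrite /porbits -imset_comp; apply/setP=> O; apply/imsetP/imsetP.
    case=> x; rewrite inE => Px ->; exists (Sub x Px) => //=.
    rewrite -{1}(SubK sT Px); set z : sT := Sub x Px.
    apply/setP=> y; apply/idP/imsetP=> [/porbit_iter[i _ ->]|[u uz ->]].
      by rewrite iter_st; exists (iter i t z) => //; apply: iter_in_porbit.
    by rewrite mem_st.
  case=> z _ -> /=; exists (val z); first by rewrite inE valP.
  apply/setP=> y; apply/imsetP/idP=> [[u uz ->]|/porbit_iter[i _ ->]].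
    by rewrite mem_st.
  by rewrite iter_st; exists (iter i t z) => //; apply: iter_in_porbit.
by rewrite card_imset //; apply: imset_inj; apply: val_inj.
Qed.

(** * Components and edge deletion *)

Section Components.
Variables (V : finType) (e e' : rel V) (a b : V).
Hypotheses (e_sym : symmetric e) (e'_sym : symmetric e') (e'_sub : subrel e' e).
Hypothesis e_edge :
  forall x y, e x y -> [|| e' x y, (x == a) && (y == b) | (x == b) && (y == a)].

(** A path of [e] that uses the extra edge runs from [x] to one end of that edge
    and from one end to [y], within [e']. *)
Lemma connect_edge x y :
  connect e x y -> connect e' x y || (connect e' a x || connect e' b x) &&
                                     (connect e' a y || connect e' b y).
Proof.
have cs := sym_connect_sym e'_sym.
case/connectP=> p; elim: p x => [|z p IH] x /= => [_ ->|/andP[exz zp] Ey].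
  by rewrite connect0.
have {IH} := IH z zp Ey.
case/or3P: (e_edge exz) => [/connect1 xz|/andP[/eqP-> /eqP->]|/andP[/eqP-> /eqP->]].
- by rewrite (same_connect cs xz) !(same_connect_r cs xz).
- by rewrite !connect0 /= orbT /= => /orP[] ->; rewrite ?orbT.
- by rewrite !connect0 /= orbT /= => /orP[] ->; rewrite ?orbT.
Qed.

(** Only the component of the deleted edge can break up, and every vertex of it
    stays connected to [a] or to [b]. So the old root is injective on the new
    roots other than that of [a]. *)
Lemma n_comp_delete : n_comp e' V <= (n_comp e V).+1.
Proof.
have cs := sym_connect_sym e_sym; have cs' := sym_connect_sym e'_sym.
pose R := [set x | roots e' x].
have -> : n_comp e' V = #|R| by apply: eq_card => x; rewrite !inE andbT.
rewrite (cardsD1 (root e' a)) -add1n leq_add ?leq_b1 //.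
rewrite -(@card_in_imset _ _ (root e)) => [|x y].
  apply: subset_leq_card; apply/subsetP=> _ /imsetP[x _ ->].
  by rewrite !inE roots_root.
rewrite !inE => /andP[xa /eqP rx] /andP[ya /eqP ry] /(rootP cs)/connect_edge.
have nca z : root e' z = z -> z != root e' a -> connect e' a z = false.
  by move=> rz; apply: contraNF => /(rootP cs') ->; rewrite rz.
rewrite !nca //= => /orP[/(rootP cs')|/andP[bx byy]]; first by rewrite rx ry.
by rewrite -rx -ry; apply/(rootP cs'); rewrite (connect_trans _ byy) // cs'.
Qed.

Lemma n_comp_delete_connected : connect e' a b -> n_comp e' V = n_comp e V.
Proof.
have cs' := sym_connect_sym e'_sym.
move=> ab; apply: eq_n_comp => x y; apply/idP/idP.
  by apply: connect_sub x y => x y /e'_sub/connect1.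
move/connect_edge; rewrite -!(same_connect cs' ab) !orbb.
by case/orP=> // /andP[ax]; apply: connect_trans; rewrite cs'.
Qed.
End Components.

(** * Plane rotation systems *)

Section Maps.
Variable V : finType.
Implicit Types (D : {set V * V}) (n : {perm V * V}) (d : V * V).

Definition swap d := (d.2, d.1).

(** A graph on [V] is given by its set of darts within [V * V]. The permutations
    act on all of [V * V] and fix the pairs that are not darts; deleting edges
    thus leaves the type of darts unchanged. *)
Definition edges D : rel V := fun u v => (u, v) \in D.

Definition flip_fun D d := if (d \in D) && (swap d \in D) then swap d else d.

Lemma flip_inj D : injective (flip_fun D).
Proof.
apply: (can_inj (g := flip_fun D)) => d; rewrite /flip_fun.
have swK : swap (swap d) = d by case: d.
case E: ((d \in D) && _); last by rewrite E.
by rewrite swK andbC E.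
Qed.

Definition flip D : {perm V * V} := perm (@flip_inj D).

Definition face D n : {perm V * V} := (flip D * n)%g.

Definition simple D := (forall u v, (u, v) \in D -> (v, u) \in D)
  /\ forall u, (u, u) \notin D.

Definition rotation D n := (forall d, d \notin D -> n d = d)
  /\ forall d, d \in D -> porbit n d = [set d' in D | d'.1 == d.1].

(** Every pair outside [D] is a fixed point of both permutations, and every
    isolated vertex a component, so that [euler] is Euler's inequality
    (vertices) + (faces) >= (edges) + 2 (components) over the vertices that are
    not isolated. It is stated without any subtraction. *)
Definition euler D n :=
  #|D|./2 + 2 * n_comp (edges D) V + #|porbits n|
    <= 2 * #|V| + #|porbits (face D n)|.

Definition spherical D := exists2 n, rotation D n & euler D n.

Lemma flipE D d : simple D -> d \in D -> flip D d = swap d.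
Proof. by case: d => u v [symD _] uv; rewrite permE /flip_fun uv symD. Qed.

Lemma flip_out D d : d \notin D -> flip D d = d.
Proof. by move=> dD; rewrite permE /flip_fun (negPf dD). Qed.

Lemma edges_sym D : simple D -> symmetric (edges D).
Proof. by case=> symD _ u v; apply/idP/idP; apply: symD. Qed.

Lemma faceE D n d : simple D -> d \in D -> face D n d = n (swap d).
Proof. by move=> sD dD; rewrite permM flipE. Qed.

Lemma rot_mem D n : rotation D n -> forall d, (n d \in D) = (d \in D).
Proof. by case=> fixD _; apply: fixed_stable. Qed.

Lemma rot_src D n d : rotation D n -> d \in D -> (n d).1 = d.1.
Proof.
move=> [_ /(_ d) rotD] /rotD E.
have : n d \in porbit n d by rewrite porbit_next porbit_id.
by rewrite E inE => /andP[_ /eqP].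
Qed.

Lemma swap_mem D d : simple D -> (swap d \in D) = (d \in D).
Proof. by case: d => u v [symD _]; apply/idP/idP; apply: symD. Qed.

Lemma face_fix D n d : rotation D n -> d \notin D -> face D n d = d.
Proof. by case=> fixD _ dD; rewrite permM flip_out // fixD. Qed.

Lemma face_mem D n : rotation D n -> forall d, (face D n d \in D) = (d \in D).
Proof. by move=> rn; apply: fixed_stable => d; apply: face_fix. Qed.

Lemma face_src D n d : simple D -> rotation D n -> d \in D -> (face D n d).1 = d.2.
Proof. by move=> sD rn dD; rewrite faceE // (rot_src rn) // swap_mem. Qed.

Definition delete D (x : V * V) := D :\ x :\ swap x.

Lemma simple_delete D x : simple D -> simple (delete D x).
Proof.
move=> [symD irrD]; split=> [u v|u]; last by rewrite !inE (negPf (irrD u)) !andbF.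
rewrite !inE => /and3P[n1 n2 /symD ->]; rewrite andbT.
case: x n1 n2 => p q; rewrite /swap !xpair_eqE /= => n1 n2.
by rewrite ![(v == _) && _]andbC n2 n1.
Qed.

Lemma swap_neq D x : simple D -> x \in D -> swap x != x.
Proof. by case: x => u v [_ irr] uv; apply: contraTneq uv => -[-> _]. Qed.

Lemma card_delete D x : simple D -> x \in D -> #|D| = #|delete D x|.+2.
Proof.
move=> sD xD; rewrite (cardsD1 x) xD (cardsD1 (swap x) (D :\ x)) !inE.
rewrite swap_mem // xD andbT.
by rewrite (swap_neq sD xD).
Qed.

Lemma rotation_bypass D n x :
  rotation D n -> rotation (D :\ x) (bypass n x).
Proof.
move=> [fixD rotD]; split=> d; rewrite !inE.
  rewrite bypassE negb_and negbK; have [//|dx /= dD] := eqVneq d x.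
  by rewrite fixD // (negPf dx).
case/andP=> dx dD; rewrite porbit_bypass // rotD //.
by apply/setP=> y; rewrite !inE andbA.
Qed.

(** Deleting an edge changes the number of faces by one. If the two sides of the
    edge belong to one face, that face splits, and the number of components
    grows by at most one. If they belong to two faces, these merge; walking
    around one of them, past the edge, joins the ends of the edge in what
    remains, so that no component is created. Euler's inequality survives in
    either case. *)
Lemma spherical_delete D x :
  simple D -> x \in D -> spherical D -> spherical (delete D x).
Proof.
move=> sD xD [n rn euD]; pose y := swap x.
have yD : y \in D by rewrite swap_mem.
have xy : x != y by rewrite eq_sym (swap_neq sD xD).
have yK : swap y = x by rewrite /y; case: (x).
pose n1 := bypass n x; pose n2 := bypass n1 y.
have rn2 : rotation (delete D x) n2 by do 2!apply: rotation_bypass.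
exists n2 => //.
pose g1 : {perm V * V} := (tperm x y * face D n)%g.
have g1x : g1 x = n x by rewrite permM tpermL faceE // yK.
have g2y : bypass g1 x y = n1 y.
  rewrite /n1 /bypass g1x !permM tpermR; congr (tperm x (n x) _).
  by rewrite -permM -/(face D n) faceE.
have Ef : face (delete D x) n2 = bypass (bypass g1 x) y.
  rewrite /bypass g2y g1x /g1 /face /n2 {1}/bypass /n1 {1}/bypass !mulgA.
  congr (_ * _ * _ * _)%g; apply/permP=> z; rewrite permM.
  case: tpermP => [->|->|/eqP zx /eqP zy].
  - by rewrite (flipE sD yD) yK flip_out // !inE eqxx !andbF.
  - by rewrite (flipE sD xD) flip_out // !inE eqxx.
  have swI u v : (swap u == swap v) = (u == v).
    by case: u v => [? ?] [? ?]; rewrite /swap !xpair_eqE andbC.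
  have szx : (swap z == x) = false by rewrite -yK swI (negPf zy).
  by rewrite !permE /flip_fun !inE -/y zx zy szx /y swI (negPf zx).
(* Unlinking [x] from [y] merges or splits faces; bypassing [x] and [y] then
   creates as many new orbits in the faces as in the rotation. *)
have cf : #|porbits (face (delete D x) n2)| + (x \notin porbit (face D n) y).*2
    + #|porbits n| = #|porbits (face D n)| + #|porbits n2| + 1.
  rewrite Ef /n2 !card_porbits_bypass g1x g2y.
  have cg1 : #|porbits g1| + (x \notin porbit (face D n) y).*2
      = #|porbits (face D n)| + 1 by rewrite card_porbits_tperm xy.
  move: (#|porbits g1|) (#|porbits (face D n)|) (#|porbits n|) cg1.
  move: (n x != x) (n1 y != y) (x \notin _) => b1 b2 b3 c1 c2 c3.
  lia.
have symD' := edges_sym (simple_delete x sD); have symD := edges_sym sD.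
have subD : subrel (edges (delete D x)) (edges D).
  by move=> u v; rewrite /edges !inE => /and3P[].
have edgeD u v : edges D u v -> [|| edges (delete D x) u v,
    (u == x.1) && (v == x.2) | (u == x.2) && (v == x.1)].
  rewrite /edges !inE => ->; rewrite andbT.
  case: eqP => [[-> ->]|_]; first by rewrite !eqxx orbT.
  by case: eqP => [<-|_] //; rewrite !eqxx.
move: euD; rewrite /euler (card_delete sD xD) /=.
have := n_comp_delete symD symD' edgeD.
case xfy : (x \in porbit (face D n) y) cf => /=; first lia.
suff /(n_comp_delete_connected symD' subD edgeD) -> :
  connect (edges (delete D x)) x.1 x.2.
  move: (#|porbits (face (delete D x) n2)|) (#|porbits n2|).
  move: (#|porbits n|) (#|porbits (face D n)|) => p1 p2 p3 p4.
  move: (#|V|) (n_comp (edges D) V) (#|delete D x|) => c1 c2 c3.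
  lia.
(* The face of [y] starts, after [y] itself, at a dart leaving the source of [x],
   and meets neither [x] nor [y] before it closes up at [y]. *)
have walk z : z \in porbit (face D n) (face D n y) ->
    z \in porbit (face D n) y /\ connect (edges (delete D x)) x.1 z.1.
  move: z; apply: porbit_ind => [|z [zy cz]].
    by rewrite porbit_next porbit_id face_src.
  rewrite porbit_next zy; split=> //.
  have zD : z \in D by rewrite (stable_porbit (face_mem rn) zy).
  rewrite face_src //; have [->|zny] := eqVneq z y; first exact: connect0.
  apply: connect_trans cz (connect1 _).
  rewrite /edges !inE -surjective_pairing zD zny andbT.
  by apply: contraFneq xfy => <-.
have [|_ //] := walk y.
by rewrite porbit_sym porbit_next porbit_id.
Qed.

Lemma spherical_sub D D' :
  simple D -> simple D' -> D' \subset D -> spherical D -> spherical D'.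
Proof.
move=> + sD'; move: {2}#|D| (leqnn #|D|) => m.
elim: m D => [|m IH] D mD sD DD' spD.
  suff -> : D' = D by [].
  by apply/eqP; rewrite eqEcard DD'; lia.
have [->//|/eqP neD] := eqVneq D' D.
have /subsetPn[x xD xD'] : ~~ (D \subset D').
  by apply/negP=> h; apply: neD; apply/eqP; rewrite eqEsubset DD'.
apply: (IH (delete D x)); [|exact: simple_delete| |exact: spherical_delete].
  by rewrite (card_delete sD xD) in mD; lia.
apply/subsetP=> z zD'; rewrite !inE (subsetP DD') // andbT.
apply/andP; split; last by apply: contraNneq xD' => <-.
by apply: contraNneq xD' => zx; rewrite -(swap_mem _ sD') -zx.
Qed.
End Maps.

(** * Euler's formula *)

Section Euler.
Variable V : finType.
Implicit Types (D : {set V * V}) (n : {perm V * V}).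

Definition touched D : {set V} := [set u | [exists v, (u, v) \in D]].

Lemma src_touched D d : d \in D -> d.1 \in touched D.
Proof. by case: d => u v uv; rewrite inE; apply/existsP; exists v. Qed.

Lemma card_rot_orbits D n :
  rotation D n -> #|porbit n @: D| = #|touched D|.
Proof.
move=> [_ rotD]; pose h u := [set d in D | d.1 == u].
have -> : porbit n @: D = h @: touched D.
  apply/setP=> O; apply/imsetP/imsetP=> -[x xD ->].
    by exists x.1; [apply: src_touched | rewrite rotD].
  by move: xD; rewrite inE => /existsP[v xv]; exists (x, v); rewrite ?rotD.
rewrite card_in_imset // => u v; rewrite inE => /existsP[w uw] _ huv.
have : (u, w) \in h v by rewrite -huv inE uw /=.
by rewrite inE => /andP[_ /eqP].
Qed.

Lemma isolated_connect D u v :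
  u \notin touched D -> connect (edges D) u v -> v = u.
Proof.
move=> nu /connectP[[|w p] /= + -> //].
by case/andP=> uw _; case/negP: nu; apply: (src_touched uw).
Qed.

Lemma n_comp_isolated D :
  n_comp (edges D) V = n_comp (edges D) (touched D) + #|~: touched D|.
Proof.
rewrite (n_compC (touched D)); congr (_ + _).
rewrite /n_comp_mem; apply: eq_card => u; rewrite !inE.
apply/andP/idP=> [[]//|iu]; split=> //; apply/eqP.
apply: isolated_connect (connect_root _ u); first by rewrite inE.
Qed.

Lemma euler_faces D n :
  rotation D n ->
  euler D n = (#|D|./2 + 2 * n_comp (edges D) (touched D)
                <= #|touched D| + #|porbit (face D n) @: D|).
Proof.
move=> rn; rewrite /euler n_comp_isolated.
rewrite (card_porbits_split (D := D) (s := n)); last by case: rn.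
rewrite (card_porbits_split (D := D) (s := face D n)) => [|d]; last exact: face_fix.
rewrite (card_rot_orbits rn) -(cardsC (touched D)).
move: #|touched D| #|~: touched D| #|~: D| (n_comp _ _) #|D| #|_ @: _| => a b c d e f.
by apply/idP/idP; lia.
Qed.

Lemma touched_component D d :
  simple D -> d \in D -> 0 < n_comp (edges D) (touched D).
Proof.
move=> sD dD; apply/card_gt0P; exists (root (edges D) d.1).
have cs := sym_connect_sym (edges_sym sD).
set r := root _ _; apply/andP; split; first exact: roots_root.
apply/negPn/negP=> nr.
have : connect (edges D) r d.1 by rewrite cs connect_root.
by move/(isolated_connect nr) => Ed; case/negP: nr; rewrite -Ed; apply: src_touched.
Qed.

Definition darts (G : sgraph V) : {set V * V} := [set d | G d.1 d.2].

Lemma simple_darts (G : sgraph V) : simple (darts G).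
Proof. by split=> [u v|u]; rewrite !inE /= ?adj_irr // adj_sym. Qed.

Lemma spherical_planar (G : sgraph V) : planar G -> spherical (darts G).
Proof.
case=> rot rotG euG; set D := darts G.
pose ext d := if insub d is Some x then val (rot (x : dart G)) else d.
have extE (x : dart G) : ext (val x) = val (rot x) by rewrite /ext valK.
have extD d : d \notin D -> ext d = d.
  by rewrite inE => dD; rewrite /ext insubF //; apply/negbTE.
have ext_mem d : (ext d \in D) = (d \in D).
  rewrite /ext; case: insubP => [x Gd Ex|//]; rewrite !inE Gd.
  exact: (valP (rot x)).
have ext_inj : injective ext.
  move=> c d Ecd; have : (c \in D) = (d \in D) by rewrite -ext_mem Ecd ext_mem.
  have [cD /esym dD|cD /esym/negbT dD] := boolP (c \in D); last first.
    by rewrite -(extD c) // -(extD d).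
  rewrite !inE in cD dD.
  pose x : dart G := Sub c cD; pose y : dart G := Sub d dD.
  have [Ex Ey] : val x = c /\ val y = d by rewrite !SubK.
  by move: Ecd; rewrite -Ex -Ey !extE => /val_inj/perm_inj ->.
pose n := perm ext_inj.
have nE x : n (val x) = val (rot x) by rewrite permE extE.
have rn : rotation D n.
  split=> [d dD|d]; first by rewrite permE extD.
  rewrite inE => dD; pose x : dart G := Sub d dD.
  have Ex : val x = d by rewrite SubK.
  have iterE i (z : dart G) : iter i n (val z) = val (iter i rot z).
    by elim: i => //= i ->; rewrite nE.
  apply/setP=> d'; rewrite !inE; apply/idP/andP=> [|[d'D /eqP E1]].
    case/porbit_iter=> i _ ->; rewrite -Ex iterE; split; first exact: (valP (iter i rot x)).
    by rewrite -[_ == _]/(dart_src _ == dart_src _) -rotG iter_in_porbit.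
  pose y : dart G := Sub d' d'D; have Ey : val y = d' by rewrite SubK.
  have : y \in porbit rot x by rewrite rotG /dart_src Ex Ey E1.
  by case/porbit_iter=> i _ E; rewrite -Ey E -iterE Ex iter_in_porbit.
exists n => //; rewrite euler_faces //.
have faceV (x : dart G) : face D n (val x) = val (face_perm rot x).
  rewrite faceE; [|exact: simple_darts|by rewrite inE; exact: (valP x)].
  by rewrite [face_perm rot x]permM -nE [perm (@rev_dart_inj _ _) _]permE.
have -> : #|porbit (face D n) @: D| = #|porbits (face_perm rot)|.
  exact: (card_porbits_sub faceV).
have -> : #|D| = #|{: dart G}| by rewrite card_sig cardsE.
have -> : touched D = non_isolated G.
  by apply/setP=> u; rewrite !inE; apply: eq_existsb => v; rewrite inE.
rewrite euG leq_add2l leq_mul2l /=; apply: eq_leq.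
apply: eq_n_comp => u v; apply: eq_connect => {}u {}v; exact: in_set.
Qed.
End Euler.

(** * Discharging *)

Section BoolSums.
Variables (T : finType) (P : pred T).
Implicit Type O : {set T}.

Lemma sum_pred_card O : \sum_(y in O) P y <= #|O|.
Proof. by rewrite -sum1_card; apply: leq_sum => y _; case: (P y). Qed.

Lemma sum_pred_all O : #|O| <= \sum_(y in O) P y -> {in O, forall y, P y}.
Proof.
move=> le y yO; apply: contraLR le => nP.
by rewrite -ltnNge (big_setD1 y) //= (negPf nP) (cardsD1 y) yO ltnS sum_pred_card.
Qed.

Lemma sum_pred_all_but_one O :
  #|O| <= (\sum_(y in O) P y).+1 -> {in O &, forall x y, x != y -> P x || P y}.
Proof.
move=> le x y xO yO xy; apply: contraLR le; rewrite negb_or => /andP[nx ny].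
have yO' : y \in O :\ x by rewrite !inE eq_sym xy.
rewrite -ltnNge (big_setD1 x) //= (big_setD1 y) //= (negPf nx) (negPf ny).
by rewrite (cardsD1 x) xO (cardsD1 y) yO' !ltnS sum_pred_card.
Qed.

Lemma sum_pred_two O x y :
  x \in O -> y \in O -> x != y -> P x -> P y -> 2 <= \sum_(z in O) P z.
Proof.
move=> xO yO xy Px Py; rewrite (bigD1 x) //= (bigD1 y) /=; last by rewrite yO eq_sym.
by rewrite Px Py.
Qed.

Lemma sum_pred_none O : \sum_(y in O) P y = 0 -> {in O, forall y, ~~ P y}.
Proof.
by move/eqP; rewrite sum_nat_eq0 => /forall_inP P0 y /P0; case: (P y).
Qed.
End BoolSums.

Section Discharging.
Variables (V : finType) (D : {set V * V}) (n : {perm V * V}).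
Hypotheses (sD : simple D) (rn : rotation D n).

Definition deg (E : {set V * V}) u := #|[set v | (u, v) \in E]|.

Hypothesis deg_ge4 : forall d, d \in D -> 4 <= deg D d.1.

Definition triangle_free_4cycles (E : {set V * V}) := forall a b c e x,
  (a, b) \in E -> (b, c) \in E -> (c, e) \in E -> (e, a) \in E ->
  a != c -> b != e -> (x, a) \in E -> (x, b) \in E -> False.

Hypothesis no_adjacent : triangle_free_4cycles D.

(** A 5-cycle with a roof [t] over its edge [u1 u2]. *)
Definition house (E : {set V * V}) u1 u2 u3 u4 u5 t :=
  [/\ uniq [:: u1; u2; u3; u4; u5],
      [&& (u1, u2) \in E, (u2, u3) \in E, (u3, u4) \in E, (u4, u5) \in E
        & (u5, u1) \in E],
      (t, u1) \in E & (t, u2) \in E].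

Hypothesis no_house4 : forall u1 u2 u3 u4 u5 t,
  house D u1 u2 u3 u4 u5 t -> ~ all (fun u => deg D u == 4) [:: u1; u2; u3; u4; u5; t].

Local Notation phi := (face D n).
Local Notation orb d := (porbit (face D n) d).

Lemma swapK (d : V * V) : swap (swap d) = d. Proof. by case: d. Qed.

Lemma card_rot_orbit d : d \in D -> #|porbit n d| = deg D d.1.
Proof.
move=> dD; have [_ /(_ d dD) ->] := rn.
rewrite /deg -(card_imset [set v | (d.1, v) \in D] (f := pair d.1)) => [|u v []//].
apply: eq_card => -[u v]; rewrite !inE /=; apply/andP/imsetP => [[uv /eqP eu]|].
  by exists v; rewrite ?inE -eu.
by case=> w; rewrite inE => dw [-> ->]; rewrite eqxx.
Qed.

Lemma rot_neq d : d \in D -> n d != d.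
Proof.
move=> dD; apply/eqP=> fix_d; have := deg_ge4 dD.
by rewrite -card_rot_orbit // porbit_fixed // cards1.
Qed.

Lemma rot2_neq d : d \in D -> n (n d) != d.
Proof.
move=> dD; apply/eqP=> fix_d; have := deg_ge4 dD.
suff le2 : #|porbit n d| <= 2 by rewrite -card_rot_orbit // leqNgt ltnS (leq_trans le2).
apply: leq_trans (subset_leq_card _) (card_size [:: d; n d]).
apply/subsetP; apply: porbit_ind => [|z]; rewrite !inE ?eqxx //.
by case/orP=> /eqP->; rewrite ?fix_d eqxx ?orbT.
Qed.

Lemma rot4 d : d \in D -> deg D d.1 = 4 -> n (n (n (n d))) = d.
Proof. by move=> dD d4; rewrite -[RHS](iter_porbit n d) card_rot_orbit // d4. Qed.

Lemma dart_neq d : d \in D -> d.1 != d.2.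
Proof. by case: d => u v uv; apply: contraTneq uv => /= ->; case: sD. Qed.

Lemma faceD d : (phi d \in D) = (d \in D). Proof. exact: face_mem. Qed.
Lemma rotD d : (n d \in D) = (d \in D). Proof. exact: rot_mem. Qed.
Lemma swapD d : (swap d \in D) = (d \in D). Proof. exact: swap_mem. Qed.

Lemma face_swap d : d \in D -> phi (swap d) = n d.
Proof. by move=> dD; rewrite faceE ?swapK // swapD. Qed.

(** Faces never turn back along an edge, because every degree is at least 2. *)
Lemma face_nonback d : d \in D -> (phi d).2 != d.1.
Proof.
move=> dD; apply/eqP=> E; have /rot_neq/eqP[] : swap d \in D by rewrite swapD.
by rewrite -(faceE _ sD dD) [LHS]surjective_pairing face_src // E.
Qed.

Lemma orb_next d : orb (phi d) = orb d.
Proof. by apply/porbit_eqP; rewrite porbit_next porbit_id. Qed.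

Lemma orb_rot d : d \in D -> orb (n d) = orb (swap d).
Proof. by move=> dD; rewrite -face_swap // orb_next. Qed.

Definition tri d := #|orb d| == 3.

Lemma tri_next d : tri (phi d) = tri d. Proof. by rewrite /tri orb_next. Qed.

Lemma tri_rot d : d \in D -> tri (n d) = tri (swap d).
Proof. by move=> dD; rewrite /tri orb_rot. Qed.

Lemma face_pair d : d \in D -> phi d = (d.2, (phi d).2).
Proof. by move=> dD; rewrite [LHS]surjective_pairing face_src. Qed.

Lemma tri_cycle d : d \in D -> tri d -> phi (phi (phi d)) = d.
Proof. by move=> dD /eqP E; rewrite -[RHS](iter_porbit phi d) E. Qed.

Lemma tri_close d : d \in D -> tri d -> ((phi d).2, d.1) = phi (phi d).
Proof.
move=> dD Td; rewrite [RHS]face_pair ?faceD //; congr (_, _).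
by rewrite -[in LHS](tri_cycle dD Td) face_src ?faceD.
Qed.

Lemma tri_dart d : d \in D -> tri d -> ((phi d).2, d.1) \in D.
Proof. by move=> dD Td; rewrite tri_close // !faceD. Qed.

Lemma face_ge3 d : d \in D -> 3 <= #|orb d|.
Proof.
move=> dD; have := iter_porbit phi d; have := card_porbit_neq0 phi d.
case: #|_| => [|[|[|//]]] //= _ E; exfalso.
  by have := face_src sD rn dD; rewrite E => /eqP; rewrite (negPf (dart_neq dD)).
case/eqP: (face_nonback dD).
by rewrite -[X in _ = X.1]E face_src // faceD.
Qed.

(** Two triangles on one edge [a b] form a 4-cycle through their other vertices,
    unless these coincide; but then [b] would have degree 2. *)
Lemma tri_nonadjacent d : d \in D -> tri d -> ~~ tri (swap d).
Proof.
move=> dD Td; apply/negP=> Ts; have sdD : swap d \in D by rewrite swapD.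
set x := (phi d).2; set y := (phi (swap d)).2.
have xy : x != y.
  apply: contraNneq (rot2_neq dD) => xy; apply/eqP.
  have E : swap (n d) = phi (phi d).
    by rewrite -face_swap // -tri_close // (face_pair sdD) -/y -xy.
  by rewrite -face_swap ?rotD // E tri_cycle.
have dp : phi d \in D by rewrite faceD.
have dp' : phi (swap d) \in D by rewrite faceD.
have Ed := surjective_pairing d.
apply: (@no_adjacent d.1 x d.2 y d.2).
- by rewrite -[(_, _)]swapK swapD; apply: tri_dart.
- by rewrite -[(_, _)]swapK swapD /swap /= -face_pair.
- by have := tri_dart sdD Ts; rewrite -[(_, _)]swapK swapD.
- by rewrite -[(_, _)]swapK swapD /swap /= -[d.1]/(swap d).2 -face_pair.
- exact: dart_neq.
- exact: xy.
- by rewrite -[(_, _)]swapK swapD /swap /= -Ed.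
- by rewrite /x -face_pair.
Qed.

Lemma tri_next_rot d : d \in D -> tri d -> ~~ tri (n d).
Proof. by move=> dD Td; rewrite tri_rot // tri_nonadjacent. Qed.

Lemma face4_nonadjacent d : d \in D -> #|orb d| = 4 -> ~~ tri (swap d).
Proof.
move=> dD d4; apply/negP=> Ts; have sdD : swap d \in D by rewrite swapD.
have E4 : phi (phi (phi (phi d))) = d by rewrite -[RHS](iter_porbit phi d) d4.
set d1 := phi d; set d2 := phi d1; set d3 := phi d2.
have D1 : d1 \in D by rewrite faceD. have D2 : d2 \in D by rewrite faceD.
have D3 : d3 \in D by rewrite faceD.
have s1 : d1.1 = d.2 by rewrite face_src. have s2 : d2.1 = d1.2 by rewrite face_src.
have s3 : d3.1 = d2.2 by rewrite face_src.
have s4 : d.1 = d3.2 by rewrite -[in LHS]E4 face_src.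
have tt := tri_dart sdD Ts; have nb := face_nonback dD; have nb1 := face_nonback D1.
apply: (@no_adjacent d.1 d.2 d1.2 d2.2 (phi (swap d)).2).
- by rewrite -surjective_pairing.
- by rewrite -s1 -surjective_pairing.
- by rewrite -s2 -surjective_pairing.
- by rewrite -s3 s4 -surjective_pairing.
- by rewrite eq_sym.
- by rewrite -s1 eq_sym.
- have : swap (phi (swap d)) \in D by rewrite swapD faceD.
  by rewrite /swap /= face_src.
- exact: tt.
Qed.

(** As faces do not turn back, the five positions on a 5-face, any two of which
    are at most two steps apart, are distinct vertices. With a common neighbour
    of degree 4 of two consecutive ones, they would form a house of 4-vertices. *)
Lemma face5_neighbour d t :
  d \in D -> #|orb d| = 5 -> {in orb d, forall y, deg D y.1 = 4} ->
  (t, d.1) \in D -> (t, d.2) \in D -> deg D t != 4.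
Proof.
move=> dD d5 all4 td1 td2; apply/eqP=> t4.
have E5 : phi (phi (phi (phi (phi d)))) = d by rewrite -[RHS](iter_porbit phi d) d5.
set d1 := phi d in E5; set d2 := phi d1 in E5; set d3 := phi d2 in E5.
set d4 := phi d3 in E5.
have D1 : d1 \in D by rewrite faceD. have D2 : d2 \in D by rewrite faceD.
have D3 : d3 \in D by rewrite faceD. have D4 : d4 \in D by rewrite faceD.
have s1 : d1.1 = d.2 by rewrite face_src. have s2 : d2.1 = d1.2 by rewrite face_src.
have s3 : d3.1 = d2.2 by rewrite face_src. have s4 : d4.1 = d3.2 by rewrite face_src.
have s5 : d.1 = d4.2 by rewrite -[in LHS]E5 face_src.
have Od : d \in orb d := porbit_id _ _.
have O1 : d1 \in orb d by rewrite porbit_next.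
have O2 : d2 \in orb d by rewrite porbit_next.
have O3 : d3 \in orb d by rewrite porbit_next.
have O4 : d4 \in orb d by rewrite porbit_next.
have nb0 := face_nonback dD; have nb1 := face_nonback D1; have nb2 := face_nonback D2.
have nb3 := face_nonback D3; have nb4 := face_nonback D4.
have m0 := dart_neq dD; have m1 := dart_neq D1; have m2 := dart_neq D2.
have m3 := dart_neq D3; have m4 := dart_neq D4.
rewrite -/d1 -/d2 -/d3 -/d4 ?E5 in nb0 nb1 nb2 nb3 nb4.
rewrite -?s1 -?s2 -?s3 -?s4 -?s5 in nb0 nb1 nb2 nb3 nb4 m0 m1 m2 m3 m4 td2.
apply: (@no_house4 d.1 d1.1 d2.1 d3.1 d4.1 t); last first.
  by rewrite /= t4 !all4.
split=> //; last first.
  by rewrite s1 -surjective_pairing dD -s1 s2 -surjective_pairing D1 -s2 s3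
    -surjective_pairing D2 -s3 s4 -surjective_pairing D3 -s4 s5 -surjective_pairing D4.
rewrite /= !inE !negb_or m0 m1 m2 m3 /= [d.1 == d4.1]eq_sym m4.
by rewrite [d.1 == d2.1]eq_sym nb0 nb3 [d1.1 == _]eq_sym nb1 nb4 [d2.1 == _]eq_sym nb2.
Qed.

(** Charges are counted in sixths: a vertex starts with 6 (degree - 4), a face
    with 6 (size - 4). Every face gives 2 to each triangle next to it, which
    leaves only the 5-faces with [tau] >= 4 triangular edges negative, at
    - 2 (tau - 3). They are paid by their vertices of degree at least 5, whose
    number is [beta]: a single one pays all, several ones pay half of it each. If
    there is none, the apex of each triangle next to them [send]s 1 across the
    base. *)
Definition big (d : V * V) := 5 <= deg D d.1.
Definition tau (O : {set V * V}) := \sum_(y in O) tri (swap y).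
Definition beta (O : {set V * V}) := \sum_(y in O) big y.
Definition bad (O : {set V * V}) := (#|O| == 5) && (4 <= tau O).

Definition pay d : nat :=
  if big d && bad (orb d) then (tau (orb d) - 3) * (1 + (beta (orb d) == 1)) else 0.
Definition receive d : nat := [&& tri (swap d), bad (orb d) & beta (orb d) == 0].
Definition send d : nat := receive (swap (phi d)).

Lemma small_deg d : d \in D -> ~~ big d -> deg D d.1 = 4.
Proof. by move=> /deg_ge4; rewrite /big -ltnNge => le lt; lia. Qed.

Lemma orbD d y : d \in D -> y \in orb d -> y \in D.
Proof. by move=> dD /(stable_porbit (face_mem rn)) ->. Qed.

(** The inequality says that the face is nonnegative in the end: a triangle
    receives 2 for each of its edges, and a face loses 2 for each triangular one.
    Sizes 3 and 4 are safe since two triangles, or a triangle and a 4-face, never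
    share an edge, and from size 6 on the initial charge suffices. *)
Lemma face_charge d : d \in D ->
  24 + \sum_(y in orb d) 2 * tri (swap y)
    <= \sum_(y in orb d) (6 + 2 * tri y + (pay y + receive y)).
Proof.
move=> dD; set O := orb d.
have Oy y : y \in O -> orb y = O by move/porbit_eqP.
rewrite -big_distrr /= -/(tau O).
have -> : \sum_(y in O) (6 + 2 * tri y + (pay y + receive y))
   = #|O| * (6 + 2 * tri d) + \sum_(y in O) (pay y + receive y).
  rewrite -sum_nat_const -big_split; apply: eq_bigr => y /Oy Ey.
  by rewrite /tri Ey.
have tau_le : tau O <= #|O| by apply: sum_pred_card.
have k3 : 3 <= #|O| by apply: face_ge3.
have tau34 : #|O| = 3 \/ #|O| = 4 -> tau O = 0.
  move=> k34; apply: big1 => y yO; have yD := orbD dD yO.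
  apply/eqP; rewrite eqb0; case: k34 => kO.
    by apply: tri_nonadjacent => //; rewrite /tri Oy ?kO.
  by apply: face4_nonadjacent => //; rewrite Oy.
have bad_pay : bad O -> 2 * (tau O - 3) <= \sum_(y in O) (pay y + receive y).
  move=> badO; rewrite big_split /=.
  have [b0|b1] := posnP (beta O).
    have -> : \sum_(y in O) receive y = tau O.
      by apply: eq_bigr => y yO; rewrite /receive Oy // badO b0 !andbT.
    by case/andP: badO => /eqP kO ge4; lia.
  have -> : \sum_(y in O) pay y = beta O * ((tau O - 3) * (1 + (beta O == 1))).
    rewrite big_distrl; apply: eq_bigr => y yO; rewrite /pay Oy // badO andbT.
    by case: (big y); rewrite /= ?mul1n ?mul0n.
  by case: (beta O =P 1) b1 => [->|b1 b0] /=; nia.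
rewrite /tri -/O; move: bad_pay; rewrite /bad.
move: tau_le k3 tau34; move: #|O| (tau O) (\sum_(y in O) _) => k t p tk k3 t34 bp.
have [k4|k4] := leqP k 4; first by rewrite t34; [case: eqP; lia | lia].
case: eqP bp => [-> bp|nk _]; last by case: eqP; lia.
by have [t4|t4] := leqP 4 t; [have := bp t4; lia | lia].
Qed.

Lemma pay_pos d : 0 < pay d -> big d /\ bad (orb d).
Proof. by rewrite /pay; case: ifP => // /andP[]. Qed.

Lemma bad_tri d : bad (orb d) -> ~~ tri d.
Proof. by rewrite /bad /tri => /andP[/eqP ->]. Qed.

Lemma bad_tau5 O : bad O -> tau O != 4 -> {in O, forall y, tri (swap y)}.
Proof.
case/andP=> /eqP kO ge4 ne4; apply: (@sum_pred_all _ (tri \o @swap V) O).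
by rewrite -/(tau O) kO; lia.
Qed.

Lemma bad_tau O :
  bad O -> {in O &, forall x y, x != y -> tri (swap x) || tri (swap y)}.
Proof.
case/andP=> /eqP kO ge4; apply: (@sum_pred_all_but_one _ (tri \o @swap V) O).
by rewrite -/(tau O) kO.
Qed.

Lemma bad_le5 O : bad O -> tau O <= 5.
Proof. by case/andP=> /eqP <- _; apply: sum_pred_card. Qed.

Lemma pay_tri d : tri d -> pay d = 0.
Proof.
by move=> Td; case: (posnP (pay d)) => // /pay_pos[_ /bad_tri]; rewrite Td.
Qed.

(** At most one edge of a paying face is not triangular, and then it costs at
    most 2; so each triangular corner next to it accounts for 2 units. *)
Lemma pay_le_tri d : d \in D -> pay (n d) <= 2 * tri (n (n d)) + 2 * tri d.
Proof.
move=> dD; have [-> //|/pay_pos[bigd badO]] := posnP (pay (n d)).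
have sdD : swap d \in D by rewrite swapD.
have nD : n d \in D by rewrite rotD.
have sO : swap d \in orb (n d) by rewrite orb_rot // porbit_id.
have nO : n d \in orb (n d) := porbit_id _ _.
have ne : n d != swap d.
  apply: contraTneq (dart_neq dD) => E.
  by have := rot_src rn dD; rewrite E => /= ->; rewrite eqxx.
have -> : tri d = tri (swap (swap d)) by rewrite swapK.
rewrite tri_rot //.
have le5 := bad_le5 badO.
rewrite /pay bigd badO /=.
have := bad_tau badO nO sO ne.
have [t4|/(bad_tau5 badO) all5] := eqVneq (tau (orb (n d))) 4; last first.
  by rewrite !all5 //= => _; case: (_ == 1); lia.
by rewrite t4; do 2!case: (tri _) => //; case: (_ == 1).
Qed.

Lemma pay_le2 d : d \in D -> ~~ tri (n d) -> pay d <= 2.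
Proof.
move=> dD nT; have := @pay_le_tri (n^-1 d)%g.
by rewrite -rotD permKV dD (negPf nT) => /(_ isT); case: (tri _); lia.
Qed.

Lemma pay_le4 d : pay d <= 4.
Proof.
rewrite /pay; case: ifP => // /andP[_ /bad_le5].
by case: (_ == 1); lia.
Qed.

Lemma send_tri d : d \in D -> send d <= tri d.
Proof.
move=> dD; rewrite /send /receive swapK tri_next.
by case: (tri d); rewrite /= ?leq_b1.
Qed.

Lemma send_pos d : d \in D -> 0 < send d ->
  [/\ tri d, #|orb (swap (phi d))| = 5
    & {in orb (swap (phi d)), forall y, deg D y.1 = 4}].
Proof.
move=> dD; rewrite lt0b swapK tri_next => /and3P[Td /andP[/eqP k5 _] /eqP b0].
split=> // y yO; apply: small_deg; last exact: (sum_pred_none (P := big) b0).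
by apply: orbD yO; rewrite swapD faceD.
Qed.

Lemma send_big d : d \in D -> 0 < send d -> big d.
Proof.
move=> dD /(send_pos dD)[Td k5 all4]; apply: contraLR isT => /(small_deg dD) d4.
have pD : phi d \in D by rewrite faceD.
have := @face5_neighbour (swap (phi d)) d.1.
rewrite swapD pD k5 d4 /= => /(_ isT erefl all4).
have E := tri_dart dD Td; rewrite -swapD /swap /= in E.
by rewrite E face_src // -surjective_pairing dD => /(_ isT isT).
Qed.

Lemma pay_big d : 2 < pay d ->
  {in orb d, forall y, tri (swap y)} /\ {in orb d, forall y, y != d -> ~~ big y}.
Proof.
rewrite /pay; case: ifP => // /andP[bigd badO] gt2.
have le5 := bad_le5 badO; have [_ ge4] := andP badO.
have t5 : tau (orb d) != 4.
  by apply: contraTneq gt2 => ->; case: (_ == 1).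
split; first exact: bad_tau5.
move=> y yO yd; apply/negP=> bigy.
have : 2 <= beta (orb d).
  by apply: sum_pred_two (porbit_id _ _) yO _ bigd bigy; rewrite eq_sym.
by move: gt2; case: eqP => [->|_] //=; lia.
Qed.

(** Let a triangle with apex [d.1] send charge across its base to a face of
    4-vertices. If the face next to one of its other sides drew more than 2 from
    the apex, all edges of that face would be triangular, and its vertices other
    than the apex of degree 4. At the end of the base that lies on it, the four
    darts then leave room for a single further triangle, which shares an edge
    with the face across the base; its third vertex has degree 4 and yields a
    house of 4-vertices. *)
Lemma send_pay_next d : d \in D -> 0 < send d -> pay (n d) <= 2.
Proof.
move=> dD sendd; have [Td k5 all4] := send_pos dD sendd.
rewrite leqNgt; apply/negP=> /pay_big[allT small].
have sdD : swap d \in D by rewrite swapD.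
have pD : phi d \in D by rewrite faceD.
have spD : swap (phi d) \in D by rewrite swapD.
set F := orb (n d) in allT small.
have sdF : swap d \in F by rewrite /F orb_rot // porbit_id.
pose h := n (phi d); pose g := n h.
have hD : h \in D by rewrite rotD. have gD : g \in D by rewrite rotD.
have nd1 : (n d).1 = d.1 by rewrite (rot_src rn).
have u4 : deg D d.2 = 4.
  apply: (small_deg sdD); apply: small => //.
  apply: contraNneq (dart_neq dD) => E; by rewrite -nd1 -E.
have r4 : n g = swap d.
  by rewrite /g /h faceE // rot4.
have sgF : swap g \in F.
  by rewrite -(porbit_next phi) face_swap // r4.
have Tg : tri g by rewrite -[g]swapK; apply: allT.
have h1 : h.1 = d.2 by rewrite (rot_src rn) // face_src.
have g1 : g.1 = d.2 by rewrite (rot_src rn).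
have a4 : deg D g.2 = 4.
  have := @small_deg (swap g); rewrite swapD gD; apply=> //; apply: small => //.
  apply/eqP=> E.
  have := @face_nonback (swap g); rewrite swapD gD face_swap // r4 => /(_ isT).
  by rewrite E nd1 eqxx.
have Tsh : tri (swap h) by rewrite -tri_rot.
have shD : swap h \in D by rewrite swapD.
have hO : h \in orb (swap (phi d)) by rewrite /h -orb_rot // porbit_id.
have := @face5_neighbour h g.2 hD.
rewrite (porbit_eqP _ _ _ hO) k5 a4 /= => /(_ erefl all4).
have -> : (g.2, h.1) \in D by rewrite h1 -g1 -[(_, _)]/(swap g) swapD.
have := tri_dart shD Tsh; rewrite face_swap // -/g => ->.
by move=> /(_ isT isT).
Qed.

Lemma send_pay_prev d : n d \in D -> 0 < send (n d) -> pay d <= 2.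
Proof.
set d' := n d => dD sendd; have [Td k5 all4] := send_pos dD sendd.
rewrite leqNgt; apply/negP=> /pay_big[allT small].
have d0D : d \in D by rewrite -rotD.
have pD : phi d' \in D by rewrite faceD.
pose e := phi (phi d'); have eD : e \in D by rewrite !faceD.
have ne : n (swap e) = d' by rewrite -(faceE n sD eD) tri_cycle.
have Ed : d = swap e by apply: (@perm_inj _ n); rewrite ne.
have d1 : d'.1 = d.1 by rewrite (rot_src rn).
pose h := n e; have hD : h \in D by rewrite rotD.
have phid : phi d = h by rewrite Ed face_swap.
have h1 : h.1 = d.2 by rewrite -phid face_src.
have hF : h \in orb d by rewrite -phid porbit_next porbit_id.
have Tsh : tri (swap h) by apply: allT.
have x4 : deg D h.1 = 4.
  apply: small_deg => //; apply: small => //.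
  by apply: contraNneq (dart_neq d0D) => E; rewrite -h1 E.
have c4 : deg D h.2 = 4.
  have := @small_deg (phi h); rewrite faceD hD face_src //; apply=> //.
  apply: small; first by rewrite porbit_next.
  by apply: contraNneq (face_nonback d0D) => E; rewrite phid -(face_src sD rn hD) E.
have shD : swap h \in D by rewrite swapD.
pose g := n h; have gD : g \in D by rewrite rotD.
have g1 : g.1 = h.1 by rewrite (rot_src rn).
have e1 : e.1 = h.1 by rewrite /h (rot_src rn).
have ng : n g = swap (phi d').
  apply: (@perm_inj _ n); rewrite -(faceE n sD pD) -/e.
  by rewrite /g /h rot4 // e1.
have sgO : swap g \in orb (swap (phi d')).
  by rewrite -(porbit_next phi) face_swap // ng porbit_id.
have := @face5_neighbour (swap g) h.2.
rewrite swapD gD (porbit_eqP _ _ _ sgO) k5 c4 /= => /(_ isT erefl all4).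
have := tri_dart shD Tsh; rewrite face_swap // -/g => E.
have -> : (h.2, g.2) \in D by rewrite -swapD.
have -> : (h.2, g.1) \in D by rewrite g1 -[(_, _)]/(swap h) swapD.
by move=> /(_ isT isT).
Qed.

(** If an edge has a paying corner of [d.1] on both sides, its other end would,
    with degree 4, lie on two adjacent triangles. So that end shares the cost. *)
Lemma pay_both d : d \in D -> 0 < pay d -> 0 < pay (n d) -> pay d <= 1 /\ pay (n d) <= 1.
Proof.
move=> dD /pay_pos[bigd badB] /pay_pos[bigw badC].
have sdD : swap d \in D by rewrite swapD.
have nT : ~~ tri d := bad_tri badB.
have nTs : ~~ tri (swap d) by rewrite -tri_rot // bad_tri.
have dB : d \in orb d := porbit_id _ _.
have sdC : swap d \in orb (n d) by rewrite orb_rot // porbit_id.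
have tB : tau (orb d) = 4.
  by apply/eqP; apply: contraNT nTs => /(bad_tau5 badB) ->.
have tC : tau (orb (n d)) = 4.
  by apply/eqP; apply: contraNT nT => /(bad_tau5 badC)/(_ _ sdC); rewrite swapK.
pose g := phi d; have gD : g \in D by rewrite faceD.
have g1 : g.1 = d.2 by apply: face_src.
have gB : g \in orb d by rewrite porbit_next.
have gd : g != d by apply: contraNneq (dart_neq dD) => E; rewrite -g1 E.
have Eg : g = n (swap d) by rewrite /g faceE.
have big2 : big (swap d).
  apply: contraLR isT => /(small_deg sdD) e4.
  have r4 := rot4 sdD e4; rewrite -Eg in r4.
  have Tg : tri (n g).
    by rewrite tri_rot //; have := bad_tau badB gB dB gd; rewrite (negPf nTs) orbF.
  have ngD : n g \in D by rewrite rotD.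
  pose h := n (n g); have hD : h \in D by rewrite rotD.
  have shC : swap h \in orb (n d).
    by rewrite -(porbit_next phi) face_swap // r4.
  have hd : swap h != swap d.
    apply: contraNneq (dart_neq dD) => E.
    have : h.1 = d.2 by rewrite /h !(rot_src rn).
    by rewrite -[h]swapK E swapK => ->.
  have := bad_tau badC shC sdC hd; rewrite !swapK (negPf nT) orbF => Th.
  by case/negP: (tri_nonadjacent ngD Tg); rewrite -tri_rot.
have nd1 : (n d).1 = d.1 by rewrite (rot_src rn).
have bB : 2 <= beta (orb d).
  by apply: (sum_pred_two gB dB gd) => //; rewrite /big g1.
have bC : 2 <= beta (orb (n d)).
  apply: (sum_pred_two (porbit_id _ _) sdC _ bigw big2).
  by apply: contraNneq (dart_neq dD) => E; rewrite -nd1 E.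
rewrite /pay bigd badB bigw badC /= tB tC.
by split; rewrite gtn_eqF.
Qed.

(** The estimates at one vertex, on the sequence of its corners: [T i] tells
    whether the [i]th one is triangular, [p i] and [q i] are what it pays and
    sends. The last three fields combine the case distinctions of
    [send_pay_next], [send_pay_prev] and [pay_both] into linear inequalities. *)
Record corner_bounds (T : nat -> bool) (p q : nat -> nat) := CornerBounds {
  corner_alt : forall i, T i + T i.+1 <= 1;
  corner_pay : forall i, p i.+1 <= 2 * T i.+2 + 2 * T i;
  corner_send : forall i, q i <= T i;
  corner_next : forall i, p i.+1 + 2 * q i <= 4;
  corner_prev : forall i, p i + 2 * q i.+1 <= 4;
  corner_both : forall i, p i + p i.+1 <= 2 + 2 * (T i + T i.+1) }.

Lemma corner_sum5 T p q : corner_bounds T p q ->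
  (forall i, T (5 + i) = T i /\ p (5 + i) = p i /\ q (5 + i) = q i) ->
  \sum_(i < 5) (p i + q i) <= 6.
Proof.
move=> [h1 h2 h3 h4 h5 h6] per.
have [T5 [p5 q5]] := per 0; have [T6 _] := per 1; rewrite /= in T5 p5 q5 T6.
rewrite !big_ord_recr big_ord0 /=.
have A i := conj (h1 i) (conj (h2 i) (conj (h3 i) (conj (h4 i)
  (conj (h5 i) (h6 i))))).
have := A 4; have := A 3; have := A 2; have := A 1; have := A 0.
rewrite T5 T6 p5 q5 => {A h1 h2 h3 h4 h5 h6 per T5 T6 p5 q5}.
move: (p 0) (p 1) (p 2) (p 3) (p 4) (q 0) (q 1) (q 2) (q 3) (q 4).
case: (T 0); case: (T 1); case: (T 2); case: (T 3); case: (T 4);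
  by move=> ? ? ? ? ? ? ? ? ? ? [? [? [? [? [? ?]]]]] [? [? [? [? [? ?]]]]]
    [? [? [? [? [? ?]]]]] [? [? [? [? [? ?]]]]] [? [? [? [? [? ?]]]]]; lia.
Qed.

Lemma corner_sum6 T p q : corner_bounds T p q ->
  (forall i, T (6 + i) = T i /\ p (6 + i) = p i /\ q (6 + i) = q i) ->
  \sum_(i < 6) (p i + q i) <= 12.
Proof.
move=> [h1 h2 h3 h4 h5 h6] per.
have [T6 [p6 q6]] := per 0; have [T7 _] := per 1; rewrite /= in T6 p6 q6 T7.
rewrite !big_ord_recr big_ord0 /=.
have A i := conj (h1 i) (conj (h2 i) (conj (h3 i) (conj (h4 i) (h5 i)))).
have := A 5; have := A 4; have := A 3; have := A 2; have := A 1; have := A 0.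
rewrite T6 T7 p6 q6 => {A h1 h2 h3 h4 h5 h6 per T6 T7 p6 q6}.
move: (p 0) (p 1) (p 2) (p 3) (p 4) (p 5) (q 0) (q 1) (q 2) (q 3) (q 4) (q 5).
case: (T 0); case: (T 1); case: (T 2); case: (T 3); case: (T 4); case: (T 5);
  by move=> ? ? ? ? ? ? ? ? ? ? ? ? [? [? [? [? ?]]]] [? [? [? [? ?]]]]
    [? [? [? [? ?]]]] [? [? [? [? ?]]]] [? [? [? [? ?]]]] [? [? [? [? ?]]]]; lia.
Qed.

(** A triangular corner accounts for at most 2 + 2 + 1 units, and at most half of
    the corners are triangular, which suffices from degree 7 on. For degrees 5 and
    6 this is too coarse when triangles take every second corner; there the
    savings near corners that send charge are needed. *)
Lemma vertex_charge d : d \in D ->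
  \sum_(y in porbit n d) (pay y + send y) + 24 <= 6 * #|porbit n d|.
Proof.
move=> dD.
have oD i : iter i n d \in D by elim: i => //= i; rewrite rotD.
have memD y : y \in porbit n d -> y \in D by case/porbit_iter=> i _ ->.
have srcE y : y \in porbit n d -> y.1 = d.1.
  by case/porbit_iter=> i _ ->; elim: i => //= i IH; rewrite (rot_src rn).
have kE := card_rot_orbit dD; have k4 := deg_ge4 dD; rewrite -kE in k4.
have per := iter_porbit n d.
have [k5|] := ltnP #|porbit n d| 5.
  rewrite big1 => [|y yn]; first lia.
  have small : ~~ big y by rewrite /big srcE // -kE -ltnNge.
  have -> : pay y = 0 by rewrite /pay (negPf small).
  by case: (posnP (send y)) => // /(send_big (memD y yn)); rewrite (negPf small).
pose T i := tri (iter i n d); pose p i := pay (iter i n d).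
pose q i := send (iter i n d).
have cb : corner_bounds T p q.
  have alt i : T i + T i.+1 <= 1.
    have [Ti|_] := boolP (T i); last exact: leq_b1.
    by rewrite /T /= (negPf (tri_next_rot (oD i) Ti)).
  have p4 i : p i <= 4 by apply: pay_le4.
  have q1 i : q i <= 1 by apply: leq_b1.
  have p0 i : T i -> p i = 0 by apply: pay_tri.
  have pT i : p i.+1 <= 2 * T i.+2 + 2 * T i by exact: (pay_le_tri (oD i)).
  split=> // [i|i|i|i]; first exact: send_tri.
  - have := send_pay_next (oD i); rewrite -/(q i) -/(p i.+1).
    by case: (q i) (q1 i) => [|[|]//] _ h; have := p4 i.+1; [|have := h isT]; lia.
  - have := send_pay_prev (oD i.+1); rewrite -/(q i.+1) -/(p i).
    by case: (q i.+1) (q1 i.+1) => [|[|]//] _ h; have := p4 i; [|have := h isT]; lia.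
  have [Ti|nTi] := boolP (T i); first by rewrite (p0 _ Ti); have := p4 i.+1; lia.
  have [Tj|nTj] := boolP (T i.+1); first by rewrite (p0 _ Tj); have := p4 i; lia.
  have := pay_both (oD i); rewrite -/(p i) -/(p i.+1).
  have := pay_le2 (oD i) nTj; rewrite -/(p i).
  have := pT i; rewrite (negPf nTi).
  case: (p i) (p i.+1) => [|a] [|b]; [lia | by case: (T _); lia | lia |].
  by move=> _ _ /(_ isT isT)[]; lia.
have periodic k : #|porbit n d| = k ->
    forall i, T (k + i) = T i /\ p (k + i) = p i /\ q (k + i) = q i.
  by move=> <- i; rewrite /T /p /q addnC iterD per.
rewrite leq_eqVlt => /predU1P[/esym k5|].
  by rewrite big_porbit k5; apply: leq_add (corner_sum5 cb (periodic _ k5)) (leqnn 24).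
rewrite leq_eqVlt => /predU1P[/esym k6|k7].
  by rewrite big_porbit k6; apply: leq_add (corner_sum6 cb (periodic _ k6)) (leqnn 24).
have le5 : \sum_(y in porbit n d) (pay y + send y) <= 5 * \sum_(y in porbit n d) tri y.
  rewrite big_split /= -sum_porbit_next.
  have : \sum_(y in porbit n d) send y <= \sum_(y in porbit n d) tri y.
    by apply: leq_sum => y /memD; apply: send_tri.
  have : \sum_(y in porbit n d) pay (n y)
      <= \sum_(y in porbit n d) (2 * tri (n (n y)) + 2 * tri y).
    by apply: leq_sum => y /memD; apply: pay_le_tri.
  rewrite big_split -!big_distrr /= (sum_porbit_next n d (fun y => tri (n y) : nat)).
  rewrite (sum_porbit_next n d (fun y => tri y : nat)).
  move: (\sum_(y in porbit n d) pay (n y)) (\sum_(y in porbit n d) tri y).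
  move: (\sum_(y in porbit n d) send y); lia.
have alt : 2 * \sum_(y in porbit n d) tri y <= #|porbit n d|.
  rewrite mul2n -addnn -{1}(sum_porbit_next n d (fun y => tri y : nat)).
  rewrite -big_split /= -sum1_card; apply: leq_sum => y /memD yD.
  by case Ty: (tri y) => /=; [rewrite (negPf (tri_next_rot yD Ty)) | rewrite addn0 leq_b1].
move: le5 alt k7.
move: (\sum_(y in porbit n d) (pay y + send y)) (\sum_(y in porbit n d) tri y)
  #|porbit n d|.
lia.
Qed.

(** By Euler's inequality the initial charges sum to at most - 48 per component,
    whereas the final ones are nonnegative. *)
Lemma euler_deficit : D != set0 -> ~ euler D n.
Proof.
case/set0Pn=> d0 d0D; rewrite euler_faces //.
have cpos := touched_component sD d0D.
have F : 24 * #|porbit phi @: D| + \sum_(d in D) 2 * tri (swap d)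
    <= \sum_(d in D) (6 + 2 * tri d + (pay d + receive d)).
  rewrite !(sum_porbits _ faceD) mulnC -sum_nat_const -big_split /=.
  by apply: leq_sum => _ /imsetP[d dD ->]; apply: face_charge.
have W : \sum_(d in D) (pay d + send d) + 24 * #|porbit n @: D| <= 6 * #|D|.
  have -> : 6 * #|D| = \sum_(O in porbit n @: D) 6 * #|O|.
    rewrite -sum1_card (sum_porbits _ rotD) big_distrr.
    by apply: eq_bigr => O _; rewrite sum1_card.
  rewrite (sum_porbits _ rotD) mulnC -sum_nat_const -big_split /=.
  by apply: leq_sum => _ /imsetP[d dD ->]; apply: vertex_charge.
have sw : \sum_(d in D) 2 * tri (swap d) = \sum_(d in D) 2 * tri d.
  rewrite [RHS](reindex_inj (can_inj swapK)); apply: eq_bigl => d.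
  by rewrite swapD.
have sr : \sum_(d in D) send d = \sum_(d in D) receive d.
  rewrite (sum_stable (fun d => receive (swap d)) faceD).
  by rewrite [RHS](reindex_inj (can_inj swapK)); apply: eq_bigl => d; rewrite swapD.
have E : \sum_(d in D) (6 + 2 * tri d + (pay d + receive d)) = #|D| * 6
    + \sum_(d in D) 2 * tri d + (\sum_(d in D) pay d + \sum_(d in D) receive d).
  by rewrite -sum_nat_const -!big_split.
have E' : \sum_(d in D) (pay d + send d)
    = \sum_(d in D) pay d + \sum_(d in D) receive d by rewrite -sr -big_split.
move: F W; rewrite sw E E' (card_rot_orbits rn).
move: cpos; move: #|touched D| #|D| #|_ @: _| (n_comp _ _) (\sum_(d in D) pay d)
  (\sum_(d in D) receive d) (\sum_(d in D) 2 * tri d) => a b c e f g h.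
lia.
Qed.

End Discharging.

(** * Colouring vertices one at a time *)

Section Colouring.
Variables (V : finType) (G : sgraph V) (s : nat) (H : sgraph (V * 'I_s)%type).
Hypothesis coverH : is_cover G H.
Implicit Types (f r : 'I_s -> V -> nat) (l : seq (V * 'I_s)) (p q : V * 'I_s).

(** A colouring is built as a list of coloured vertices, the latest one first:
    each must conflict with fewer earlier ones than the value of its colour.
    Deleting the vertices in that order witnesses strict degeneracy. *)
Fixpoint greedy f l : bool :=
  if l is p :: l' then (count (H p) l' < f p.2 p.1) && greedy f l' else true.

Definition colouring f (A : {set V}) l :=
  [/\ uniq (unzip1 l), greedy f l & unzip1 l =i A].

Lemma cover_adj p q : p.1 != q.1 -> H p q -> G p.1 q.1.
Proof.
case: p q => [u i] [v j] /= uv; have [_ _ h] := coverH.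
by apply: contraTT => /(h _ _ uv).
Qed.

Lemma cover_inj u i j q : u != q.1 -> H (u, i) q -> H (u, j) q -> i = j.
Proof.
case: q => v k /= uv hi hj; have [_ h _] := coverH.
by have [_ ->] := h u v (@cover_adj (u, i) (v, k) uv hi) i k j k hi hj.
Qed.

Lemma cover_inj2 p u i j : p.1 != u -> H p (u, i) -> H p (u, j) -> i = j.
Proof. by rewrite ![H p _]adj_sym eq_sym; apply: cover_inj. Qed.

(** By the matching condition, a coloured vertex blocks at most one colour of each
    of its neighbours. *)
Lemma sum_conflicts v l : v \notin unzip1 l ->
  \sum_(i < s) count (H (v, i)) l <= count (G v) (unzip1 l).
Proof.
elim: l => [|q l IH] /=; first by rewrite big1.
rewrite inE negb_or => /andP[vq /IH{}IH]; rewrite big_split leq_add //.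
have [Gq|nG] := boolP (G v q.1); last first.
  rewrite big1 // => i _; apply/eqP; rewrite eqb0; apply: contra nG.
  exact: (@cover_adj (v, i)).
case: (pickP (fun i => H (v, i) q)) => [i Hi|none]; last first.
  by rewrite big1 // => i _; rewrite none.
rewrite (bigD1 i) //= Hi big1 // => j ji; apply/eqP; rewrite eqb0.
by apply: contraNN ji => Hj; rewrite (cover_inj vq Hj Hi).
Qed.

Lemma count_neighbours (A : {set V}) l v : uniq (unzip1 l) -> unzip1 l =i A ->
  count (G v) (unzip1 l) = #|[set w in A | G v w]|.
Proof.
move=> Ul EA; rewrite -size_filter -(card_uniqP (filter_uniq _ Ul)).
by apply: eq_card => w; rewrite !inE mem_filter EA andbC.
Qed.

Lemma colour_last f (A : {set V}) l v : colouring f A l -> v \notin A ->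
  #|[set w in A | G v w]| < \sum_(i < s) f i v ->
  exists l', colouring f (v |: A) l'.
Proof.
case=> Ul gl EA vA lt_deg; have vl : v \notin unzip1 l by rewrite EA.
have [i lt_i] : exists i, count (H (v, i)) l < f i v.
  apply/existsP; apply: contraLR lt_deg; rewrite negb_exists => /forallP ge.
  rewrite -leqNgt -(count_neighbours v Ul EA).
  by apply: leq_trans (sum_conflicts vl); apply: leq_sum => i _; rewrite leqNgt.
exists ((v, i) :: l); split=> /=; rewrite ?vl ?lt_i //.
by move=> w; rewrite !inE EA.
Qed.

(** In a subgraph, the vertex that was coloured last has fewer neighbours than
    the value of its colour, as these were all coloured earlier. *)
Lemma colouring_rep f l : colouring f setT l ->
  representative_set [set p in l] /\
  strictly_degenerate (rep_graph H [set p in l]) (rep_fun [set p in l] f).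
Proof.
case=> Ul gl El; have Ul' := map_uniq Ul.
have fst_inj : {in l &, injective fst}.
  move=> p q pl ql; apply: contra_eq => pq.
  rewrite -(nth_index p pl) -(nth_index p ql) -!(nth_map p p.1) ?index_mem //.
  by rewrite nth_uniq ?size_map ?index_mem // (inj_in_eq (@index_inj _ p l)).
split.
  split=> [|p q]; last first.
    by rewrite !inE => pl ql; apply: contraNneq => /fst_inj ->.
  rewrite cardsE (card_uniqP Ul') -(size_map fst) -(card_uniqP Ul).
  by apply: eq_card => v; rewrite El inE.
move=> A G' subG' /set0Pn[a0 a0A]; set R := [set p in l].
have repE v i : (v, i) \in l -> rep_fun R f v = f i v.
  move=> vil; rewrite /rep_fun; case: pickP => [j|/(_ i)]; last by rewrite inE vil.
  by rewrite inE => vjl; have [->] := fst_inj _ _ vil vjl erefl.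
have a0l : a0 \in unzip1 l by rewrite El inE.
have : forall l2 l1, greedy f l2 -> l = l1 ++ l2 -> a0 \in unzip1 l2 ->
    {in A, forall v, v \notin unzip1 l1} ->
    exists2 v, v \in A & degree G' v < rep_fun R f v; last by move/(_ l [::]); apply.
elim=> [//|[v i] l2 IH] l1 /= /andP[ltv g2] El12 a0l2 nl1.
have [vA|vA] := boolP (v \in A); last first.
  apply: (IH (rcons l1 (v, i))) => //; first by rewrite cat_rcons.
    by move: a0l2; rewrite inE => /predU1P[Ea|//]; rewrite -Ea a0A in vA.
  move=> w wA; rewrite /unzip1 map_rcons mem_rcons inE negb_or [_ \notin _]nl1 // andbT.
  by apply: contraNneq vA => /= <-.
exists v => //; have vil : (v, i) \in l by rewrite El12 mem_cat mem_head orbT.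
rewrite (repE _ _ vil); apply: leq_ltn_trans ltv.
rewrite -size_filter -(size_map fst); apply: leq_trans (card_size _).
apply: subset_leq_card; apply/subsetP=> w; rewrite inE => vw.
have [_ wA /andP[nvw /existsP[i' /existsP[j /and3P[]]]]] := subG' _ _ vw.
rewrite !inE => vi'l wjl Hvw; have [Ei] := fst_inj _ _ vi'l vil erefl.
rewrite Ei in Hvw; apply/mapP; exists (w, j) => //; rewrite mem_filter Hvw /=.
move: wjl; rewrite El12 mem_cat inE => /or3P[wl1|/eqP[Ew _]|//].
  by case/negP: (nl1 w wA); apply/mapP; exists (w, j).
by rewrite Ew eqxx in nvw.
Qed.

Definition residual f l : 'I_s -> V -> nat :=
  fun i v => f i v - count (H (v, i)) l.

Lemma greedy_cat f l l' : greedy f l -> greedy (residual f l) l' -> greedy f (l' ++ l).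
Proof.
move=> gl; elim: l' => //= -[v i] l' IH /andP[lt /IH ->]; rewrite andbT.
by move: lt; rewrite /residual ltn_subRL count_cat addnC.
Qed.

Lemma residual_sum f (B : {set V}) l v k : colouring f B l -> v \notin B ->
  k + #|[set w in B | G v w]| <= \sum_(i < s) f i v ->
  k <= \sum_(i < s) residual f l i v.
Proof.
case=> Ul gl EB vB le_k; have vl : v \notin unzip1 l by rewrite EB.
rewrite -(leq_add2r #|[set w in B | G v w]|) (leq_trans le_k) //.
rewrite -(count_neighbours v Ul EB).
apply: leq_trans (leq_add (leqnn _) (sum_conflicts vl)).
by rewrite -big_split; apply: leq_sum => i _; rewrite /residual /= addnC -leq_subLR.
Qed.

Lemma free_colour r v l : v \notin unzip1 l -> size l < \sum_(i < s) r i v ->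
  exists i, count (H (v, i)) l < r i v.
Proof.
move=> vl lt_r; apply/existsP; apply: contraLR lt_r.
rewrite negb_exists => /forallP ge; rewrite -leqNgt -(size_map fst).
apply: leq_trans (count_size (G v) _); apply: leq_trans (sum_conflicts vl).
by apply: leq_sum => i _; rewrite leqNgt.
Qed.

Lemma cover_nonadj u v i j : u != v -> ~~ G u v -> H (u, i) (v, j) = false.
Proof. by have [_ _ h] := coverH; move=> uv nuv; apply: negbTE (h u v uv nuv i j). Qed.

(** Only the non-edges of an induced house matter here: its edges enter the
    argument through the values that its vertices have left. *)
Definition hollow u1 u2 u3 u4 u5 t :=
  uniq [:: u1; u2; u3; u4; u5; t] &&
  [&& ~~ G u1 u3, ~~ G u1 u4, ~~ G u2 u4, ~~ G u2 u5, ~~ G u3 u5,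
      ~~ G t u3, ~~ G t u4 & ~~ G t u5].

Lemma hollow_sym u1 u2 u3 u4 u5 t :
  hollow u1 u2 u3 u4 u5 t -> hollow u2 u1 u5 u4 u3 t.
Proof.
case/andP=> U /and5P[n13 n14 n24 n25 /and4P[n35 nt3 nt4 nt5]].
rewrite /hollow n25 n24 n14 n13 nt3 nt4 nt5 [G u5 u3]adj_sym n35 !andbT.
rewrite -(perm_uniq (s1 := [:: u1; u2; u3; u4; u5; t])) //.
apply/seq.permP=> a /=.
by case: (a u1); case: (a u2); case: (a u3); case: (a u4); case: (a u5); case: (a t).
Qed.

Section House.
Variables (r : 'I_s -> V -> nat) (u1 u2 u3 u4 u5 t : V).
Hypothesis house_hollow : hollow u1 u2 u3 u4 u5 t.

Lemma hollow_neq : [/\ [&& u1 != u2, u1 != u3, u1 != u4, u1 != u5 & u1 != t],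
  [&& u2 != u3, u2 != u4, u2 != u5 & u2 != t],
  [&& u3 != u4, u3 != u5 & u3 != t], (u4 != u5) && (u4 != t) & u5 != t].
Proof.
case/andP: house_hollow => + _; rewrite /= !inE !negb_or.
by case/and5P=> -> -> -> -> /andP[-> _].
Qed.

Definition path_colours c1 c5 c4 c3 :=
  [&& H (u5, c5) (u1, c1) < r c5 u5, H (u4, c4) (u5, c5) < r c4 u4
    & H (u3, c3) (u4, c4) < r c3 u3].

Hypotheses (r3 : 2 <= \sum_(i < s) r i u3) (r4 : 2 <= \sum_(i < s) r i u4)
  (r5 : 2 <= \sum_(i < s) r i u5).

Lemma path_colourable c1 : exists c5 c4 c3, path_colours c1 c5 c4 c3.
Proof.
have [/and5P[_ _ _ n15 _] _ /and3P[n34 _ _] /andP[n45 _] _] := hollow_neq.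
have [|//|c5 h5] := @free_colour r u5 [:: (u1, c1)]; first by rewrite inE eq_sym.
have [|//|c4 h4] := @free_colour r u4 [:: (u5, c5)]; first by rewrite inE.
have [|//|c3 h3] := @free_colour r u3 [:: (u4, c4)]; first by rewrite inE.
exists c5, c4, c3; rewrite /= !addn0 in h5 h4 h3.
by rewrite /path_colours h5 h4 h3.
Qed.

Lemma colour_tip_last c1 c2 c3 c4 c5 ct :
  0 < r c1 u1 -> path_colours c1 c5 c4 c3 ->
  H (u2, c2) (u3, c3) + H (u2, c2) (u1, c1) < r c2 u2 ->
  H (t, ct) (u2, c2) + H (t, ct) (u1, c1) < r ct t ->
  greedy r [:: (t, ct); (u2, c2); (u3, c3); (u4, c4); (u5, c5); (u1, c1)].
Proof.
have [/and5P[n12 n13 n14 n15 n1t] /and4P[n23 n24 n25 n2t] /and3P[n34 n35 n3t]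
  /andP[n45 n4t] n5t] := hollow_neq.
case/andP: house_hollow => _ /and5P[g13 g14 g24 g25 /and4P[g35 gt3 gt4 gt5]].
move=> h1 /and3P[h5 h4 h3] h2 ht /=; rewrite !addn0.
rewrite h1 h5 (cover_nonadj _ _ n24) // (cover_nonadj _ _ n25) // h2.
rewrite (cover_nonadj _ _ n35) // [H (u3, c3) (u1, c1)]adj_sym (cover_nonadj _ _ n13) //.
rewrite [H (u4, c4) (u1, c1)]adj_sym (cover_nonadj _ _ n14) // !addn0 h3 h4.
rewrite (@cover_nonadj t u3) 1?eq_sym // (@cover_nonadj t u4) 1?eq_sym //.
by rewrite (@cover_nonadj t u5) 1?eq_sym //= !add0n ht.
Qed.

Lemma colour_tip_first c1 c2 c3 c4 c5 ct :
  0 < r ct t -> H (u1, c1) (t, ct) < r c1 u1 -> path_colours c1 c5 c4 c3 ->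
  H (u2, c2) (u3, c3) + (H (u2, c2) (u1, c1) + H (u2, c2) (t, ct)) < r c2 u2 ->
  greedy r [:: (u2, c2); (u3, c3); (u4, c4); (u5, c5); (u1, c1); (t, ct)].
Proof.
have [/and5P[n12 n13 n14 n15 n1t] /and4P[n23 n24 n25 n2t] /and3P[n34 n35 n3t]
  /andP[n45 n4t] n5t] := hollow_neq.
case/andP: house_hollow => _ /and5P[g13 g14 g24 g25 /and4P[g35 gt3 gt4 gt5]].
move=> ht h1 /and3P[h5 h4 h3] h2 /=; rewrite !addn0.
rewrite (cover_nonadj _ _ n24) // (cover_nonadj _ _ n25) // h2 h1 ht.
rewrite (cover_nonadj _ _ n35) // [H (u3, c3) (u1, c1)]adj_sym (cover_nonadj _ _ n13) //.
rewrite [H (u4, c4) (u1, c1)]adj_sym (cover_nonadj _ _ n14) //.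
rewrite adj_sym in gt3; rewrite adj_sym in gt4; rewrite adj_sym in gt5.
rewrite (cover_nonadj _ _ n3t) // (cover_nonadj _ _ n4t) // (cover_nonadj _ _ n5t) //.
by rewrite !addn0 h3 h4 h5.
Qed.

Hypotheses (r1 : 3 <= \sum_(i < s) r i u1) (r2 : 3 <= \sum_(i < s) r i u2).
Hypothesis rt : 2 <= \sum_(i < s) r i t.

Definition house_colourable :=
  exists2 l, greedy r l & perm_eq (unzip1 l) [:: u1; u2; u3; u4; u5; t].

(** If [u1] has a colour that takes no value away from [t], or if [t] has a total
    value of 3, then [t] can be coloured at the very end, after [u1], [u5], [u4],
    [u3], [u2] in this order: each of those has an uncoloured neighbour when its
    turn comes, and so value left. *)
Lemma matched_or_colourable : house_colourable \/
  (\sum_(i < s) r i t <= 2 /\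
   forall c1, 0 < r c1 u1 -> exists2 j, H (u1, c1) (t, j) & 0 < r j t).
Proof.
have [/and5P[n12 n13 n14 n15 n1t] /and4P[n23 n24 n25 n2t] /and3P[n34 n35 n3t]
  /andP[n45 n4t] n5t] := hollow_neq.
have finish c1 : 0 < r c1 u1 -> (forall c2, exists ct,
    H (t, ct) (u2, c2) + H (t, ct) (u1, c1) < r ct t) -> house_colourable.
  move=> h1 tip; have [c5 [c4 [c3 h345]]] := path_colourable c1.
  have [|//|c2] := @free_colour r u2 [:: (u3, c3); (u1, c1)].
    by rewrite !inE negb_or n23 eq_sym n12.
  rewrite /= addn0 => h2; have [ct ht] := tip c2.
  exists [:: (t, ct); (u2, c2); (u3, c3); (u4, c4); (u5, c5); (u1, c1)].
    exact: (colour_tip_last h1 h345 h2 ht).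
  by apply/seq.permP=> a /=;
    case: (a u1); case: (a u2); case: (a u3); case: (a u4); case: (a u5); case: (a t).
have [ge3|le2] := ltnP 2 (\sum_(i < s) r i t).
  left; have [|c1 h1] := @free_colour r u1 [::] isT; first exact: leq_trans r1.
  apply: (finish c1 h1) => c2.
  have [|//|ct] := @free_colour r t [:: (u2, c2); (u1, c1)].
    by rewrite !inE negb_or ![t == _]eq_sym n2t.
  by rewrite /= addn0; exists ct.
case: (pickP (fun c1 => (0 < r c1 u1) && ~~ [exists j, H (u1, c1) (t, j) && (0 < r j t)])).
  move=> c1 /andP[h1 /existsPn noj]; left; apply: (finish c1 h1) => c2.
  have [|//|ct] := @free_colour r t [:: (u2, c2)]; first by rewrite inE eq_sym.
  rewrite /= addn0 => ht; exists ct; have := noj ct.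
  by rewrite (leq_ltn_trans _ ht) // andbT adj_sym => /negPf ->; rewrite addn0.
move=> none; right; split=> // c1 h1; have := none c1; rewrite h1 /=.
by move/negbFE/existsP=> [j /andP[]]; exists j.
Qed.
End House.

(** When the total value of [t] is 2 and every colour of [u] takes value away
    from [t], then [u] cannot afford three colours of value 1. *)
Lemma heavy_colour r u t : u != t ->
  (forall i, r i u <= 2) -> 3 <= \sum_(i < s) r i u -> \sum_(i < s) r i t <= 2 ->
  (forall i, 0 < r i u -> exists2 j, H (u, i) (t, j) & 0 < r j t) ->
  exists a b x y, [/\ 1 < r a u, 0 < r b u, H (u, a) (t, x) & H (u, b) (t, y)] /\
    [/\ 0 < r x t, 0 < r y t, x != y & forall z, 0 < r z t -> z = x \/ z = y].
Proof.
move=> ut r_le2 ru rt matched.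
have [a ra] : exists a, 1 < r a u.
  apply/existsP; apply: contraLR rt; rewrite negb_exists -ltnNge => /forallP light.
  apply: leq_trans ru _.
  apply: (@leq_trans (\sum_(i < s) \sum_(j < s) H (u, i) (t, j) * (0 < r j t))).
    apply: leq_sum => i _; have := light i; rewrite -leqNgt.
    case: (posnP (r i u)) => [->//|/matched[j Hj rj] le1]; apply: (leq_trans le1).
    by rewrite (bigD1 j) //= Hj rj.
  rewrite exchange_big; apply: leq_sum => j _; rewrite -big_distrl /=.
  case: (posnP (r j t)) => [_|rj]; rewrite ?muln0 // muln1; apply: leq_trans rj.
  have /sum_conflicts le1 : u \notin unzip1 [:: (t, j)] by rewrite inE.
  have -> : \sum_(i < s) H (u, i) (t, j) = \sum_(i < s) count (H (u, i)) [:: (t, j)].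
    by apply: eq_bigr => i _; rewrite /= addn0.
  by apply: leq_trans le1 _; rewrite /= addn0 leq_b1.
have [b ba rb] : exists2 b, b != a & 0 < r b u.
  move: ru; rewrite (bigD1 a) //=; have [/eqP|] := posnP (\sum_(i < s | i != a) r i u).
    by move=> /eqP-> ; rewrite addn0 => /(leq_trans)/(_ (r_le2 a)).
  rewrite lt0n sum_nat_eq0 negb_forall => /existsP[b]; rewrite negb_imply => /andP[ba].
  by rewrite -lt0n => rb _; exists b.
have [x Hx rx] := matched a (ltnW ra); have [y Hy ry] := matched b rb.
have xy : x != y.
  by apply: contraNneq ba => xy; rewrite xy in Hx; rewrite (@cover_inj _ _ _ (t, y) ut Hy Hx).
exists a, b, x, y; split=> //; split=> // z rz.
have [->|zx] := eqVneq z x; [by left | have [->|zy] := eqVneq z y; [by right|exfalso]].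
move: rt; rewrite (bigD1 x) //= (bigD1 y) 1?eq_sym //= (bigD1 z) /=; last by rewrite zx.
by move: (r x t) (r y t) (r z t) rx ry rz => [|?] [|?] [|?] //; lia.
Qed.

(** After [matched_or_colourable], applied from both sides of the house, [t] is
    left with exactly two colours [x], [y], each of value 1, while [u1] and [u2]
    have a heavy colour of value 2 and a second one, and each of them conflicts
    with [x] or [y]. A heavy colour survives one conflict. Either both heavy
    colours conflict with the same colour of [t], or one of the two colours of
    [u1] does not conflict with the heavy colour of [u2]; in each case [t] is
    coloured first or last so that no vertex loses too much. *)
Lemma colour_house r u1 u2 u3 u4 u5 t : hollow u1 u2 u3 u4 u5 t ->
  (forall i v, r i v <= 2) ->
  3 <= \sum_(i < s) r i u1 -> 3 <= \sum_(i < s) r i u2 ->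
  2 <= \sum_(i < s) r i u3 -> 2 <= \sum_(i < s) r i u4 ->
  2 <= \sum_(i < s) r i u5 -> 2 <= \sum_(i < s) r i t ->
  house_colourable r u1 u2 u3 u4 u5 t.
Proof.
move=> hol r_le2 r1 r2 r3 r4 r5 rt.
have [//|[rt2 m1]] := matched_or_colourable hol r3 r4 r5 r1 r2 rt.
have [[l gl pl]|[_ m2]] := matched_or_colourable (hollow_sym hol) r5 r4 r3 r2 r1 rt.
  exists l => //; apply: perm_trans pl _; apply/seq.permP=> a /=.
  by case: (a u1); case: (a u2); case: (a u3); case: (a u4); case: (a u5); case: (a t).
have [/and5P[n12 n13 n14 n15 n1t] /and4P[n23 n24 n25 n2t] _ _ _] := hollow_neq hol.
have tip_last c1 c2 c3 c4 c5 ct : 0 < r c1 u1 -> path_colours r u1 u3 u4 u5 c1 c5 c4 c3 ->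
    H (u2, c2) (u3, c3) + H (u2, c2) (u1, c1) < r c2 u2 ->
    H (t, ct) (u2, c2) + H (t, ct) (u1, c1) < r ct t ->
    house_colourable r u1 u2 u3 u4 u5 t.
  move=> h1 hp h2 ht; exists [:: (t, ct); (u2, c2); (u3, c3); (u4, c4); (u5, c5); (u1, c1)].
    exact: (colour_tip_last hol h1 hp h2 ht).
  by apply/seq.permP=> a /=;
    case: (a u1); case: (a u2); case: (a u3); case: (a u4); case: (a u5); case: (a t).
have tip_first c1 c2 c3 c4 c5 ct : 0 < r ct t -> 1 < r c1 u1 ->
    path_colours r u1 u3 u4 u5 c1 c5 c4 c3 ->
    H (u2, c2) (u3, c3) + (H (u2, c2) (u1, c1) + H (u2, c2) (t, ct)) < r c2 u2 ->
    house_colourable r u1 u2 u3 u4 u5 t.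
  move=> ht h1 hp h2; exists [:: (u2, c2); (u3, c3); (u4, c4); (u5, c5); (u1, c1); (t, ct)].
    by apply: (colour_tip_first hol ht _ hp h2); apply: leq_ltn_trans (leq_b1 _) h1.
  by apply/seq.permP=> a /=;
    case: (a u1); case: (a u2); case: (a u3); case: (a u4); case: (a u5); case: (a t).
have [a [b [x [y [[ra rb Hax Hby] [rx ry xy only]]]]]] :=
  heavy_colour n1t (r_le2 ^~ u1) r1 rt2 m1.
have [p [q [x' [y' [[rp rq Hpx Hqy] [rx' ry' xy' _]]]]]] :=
  heavy_colour n2t (r_le2 ^~ u2) r2 rt2 m2.
have off u c z z' : u != t -> H (u, c) (t, z) -> z != z' -> H (u, c) (t, z') = false.
  move=> ut Hz; apply: contraNF => Hz'.
  by rewrite (@cover_inj2 (u, c) t z z' ut Hz Hz').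
have offt u c z z' : u != t -> H (u, c) (t, z) -> z != z' -> H (t, z') (u, c) = false.
  by rewrite [H (t, _) _]adj_sym; apply: off.
(* [a] and [p] are the heavy colours of [u1] and [u2], of which [a] conflicts with
   the colour [x] of [t], and [p] with [x']. *)
have [Ex|nx] := eqVneq x' x.
  rewrite {x'}Ex in Hpx rx' xy'.
  have Ey : y' = y by case: (only y' ry') xy' => [->|//]; rewrite eqxx.
  rewrite {y'}Ey in Hqy ry' xy'.
  have [c5 [c4 [c3 hp]]] := path_colourable hol r3 r4 r5 a.
  have [both|one] := boolP (H (u2, p) (u3, c3) && H (u2, p) (u1, a)).
    case/andP: both => H3 H1.
    have pq : p != q.
      apply: contraNneq xy => E; rewrite -E in Hqy.
      by rewrite (@cover_inj2 (u2, p) t x y n2t Hpx Hqy).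
    have other z : u2 != z.1 -> H (u2, p) z -> H (u2, q) z = false.
      by move=> nz Hz; apply: contraNF pq => Hz'; rewrite (cover_inj nz Hz Hz').
    apply: (tip_first a q c3 c4 c5 x) => //.
    by rewrite !other //= 1?eq_sym // (off u2 q y x) // eq_sym.
  apply: (tip_last a p c3 c4 c5 y) => //; first exact: ltnW.
    by apply: leq_trans rp; move: one; case: (H _ _) => //; case: (H _ _).
  by rewrite (offt u2 p x y) // (offt u1 a x y).
have [Ey|ny] := only x' rx'; first by rewrite Ey eqxx in nx.
rewrite {x' nx}ny in Hpx rx' xy'.
have [Hpa|nHpa] := boolP (H (u2, p) (u1, a)); last first.
  have [c5 [c4 [c3 hp]]] := path_colourable hol r3 r4 r5 a.
  apply: (tip_first a p c3 c4 c5 x) => //.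
  rewrite (negPf nHpa) (off u2 p y x) // 1?eq_sym // !addn0.
  exact: leq_ltn_trans (leq_b1 _) rp.
have ab : a != b.
  apply: contraNneq xy => E; rewrite -E in Hby.
  by rewrite (@cover_inj2 (u1, a) t x y n1t Hax Hby).
have nHpb : H (u2, p) (u1, b) = false.
  by apply: contraNF ab => Hpb; rewrite (@cover_inj2 (u2, p) u1 a b _ Hpa Hpb) // eq_sym.
have [c5 [c4 [c3 hp]]] := path_colourable hol r3 r4 r5 b.
apply: (tip_last b p c3 c4 c5 x) => //.
  by rewrite nHpb addn0; apply: leq_ltn_trans (leq_b1 _) rp.
by rewrite (offt u2 p y x) // 1?eq_sym // (offt u1 b y x) // eq_sym.
Qed.
End Colouring.

(** * Houses of 4-vertices and the induction *)

Section Structure.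
Variables (V : finType) (G : sgraph V).
Hypothesis no_adjacent : forall c4 c3 : seq V,
  is_cycle G 4 c4 -> is_cycle G 3 c3 -> ~ adjacent_cycles c4 c3.

Lemma no_triangle_on_4cycle a b c e x :
  G a b -> G b c -> G c e -> G e a -> a != c -> b != e -> G x a -> G x b -> False.
Proof.
move=> ab bc ce ea nac nbe xa xb.
have neq u v : G u v -> u != v by apply: contraTneq => ->; rewrite adj_irr.
apply: (no_adjacent (c4 := [:: a; b; c; e]) (c3 := [:: a; b; x])).
- rewrite /is_cycle /= ab bc ce ea /= !inE !negb_or nac nbe !neq //.
  by rewrite adj_sym.
- by rewrite /is_cycle /= ab [G b x]adj_sym xb xa /= !inE !negb_or !neq // adj_sym.
exists a, b; split; rewrite /cycle_edge /= !inE eqxx /=; last by rewrite eqxx.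
by rewrite eqxx.
Qed.

Definition darts_in (A : {set V}) : {set V * V} :=
  [set d | [&& G d.1 d.2, d.1 \in A & d.2 \in A]].

Lemma simple_darts_in A : simple (darts_in A).
Proof.
split=> [u v|u]; rewrite !inE /= ?adj_irr //.
by rewrite adj_sym => /and3P[-> -> ->].
Qed.

Lemma deg_in (A : {set V}) u : u \in A -> deg (darts_in A) u = #|[set w in A | G u w]|.
Proof. by move=> uA; apply: eq_card => w; rewrite !inE /= uA andbC. Qed.

(** Each further edge would close a 4-cycle that shares an edge with a
    triangle. *)
Lemma house_is_hollow (A : {set V}) u1 u2 u3 u4 u5 t :
  house (darts_in A) u1 u2 u3 u4 u5 t -> hollow G u1 u2 u3 u4 u5 t.
Proof.
case=> U /and5P[]; rewrite !inE /=.
move=> /and3P[g12 _ _] /and3P[g23 _ _] /and3P[g34 _ _] /and3P[g45 _ _] /and3P[g51 _ _].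
move=> /and3P[gt1 _ _] /and3P[gt2 _ _].
have sym u v : G u v -> G v u by rewrite adj_sym.
have T := no_triangle_on_4cycle.
have neq u v : G u v -> u != v by apply: contraTneq => ->; rewrite adj_irr.
move: (U); rewrite /= !inE !negb_or.
case/and5P=> /and4P[n12 n13 n14 n15] /and3P[n23 n24 n25] /andP[n34 n35] n45 _.
have [n13' n14' n24'] : [/\ ~~ G u1 u3, ~~ G u1 u4 & ~~ G u2 u4].
  split; apply/negP=> e.
  - by apply: (T u1 u3 u4 u5 u2) => //; apply: sym.
  - by apply: (T u4 u1 u2 u3 u5) => //; rewrite 1?eq_sym //; apply: sym.
  - by apply: (T u2 u4 u5 u1 u3) => //; rewrite 1?eq_sym //; apply: sym.
have [n25' n35'] : ~~ G u2 u5 /\ ~~ G u3 u5.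
  split; apply/negP=> e.
  - by apply: (T u5 u2 u3 u4 u1) => //; rewrite 1?eq_sym //; apply: sym.
  - by apply: (T u3 u5 u1 u2 u4) => //; rewrite 1?eq_sym //; apply: sym.
have nt1 := neq _ _ gt1; have nt2 := neq _ _ gt2.
have t3 : t != u3 by apply: contraNneq n13' => <-; apply: sym.
have t4 : t != u4 by apply: contraNneq n14' => <-; apply: sym.
have t5 : t != u5 by apply: contraNneq n25' => <-; apply: sym.
have nt3' : ~~ G t u3.
  by apply/negP=> e; apply: (T u2 u1 t u3 t) => //; rewrite 1?eq_sym //; apply: sym.
have nt4' : ~~ G t u4.
  by apply/negP=> e; apply: (T u1 t u4 u5 u2) => //; rewrite 1?eq_sym //; apply: sym.
have nt5' : ~~ G t u5.
  by apply/negP=> e; apply: (T u1 u2 t u5 t) => //; rewrite 1?eq_sym //; apply: sym.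
rewrite /hollow n13' n14' n24' n25' n35' nt3' nt4' nt5' !andbT.
rewrite -[[:: u1; u2; u3; u4; u5; t]]/(rcons [:: u1; u2; u3; u4; u5] t) rcons_uniq U andbT.
by rewrite !inE !negb_or nt1 nt2 t3 t4 t5.
Qed.

Lemma house_sub (A : {set V}) u1 u2 u3 u4 u5 t :
  house (darts_in A) u1 u2 u3 u4 u5 t -> {subset [:: u1; u2; u3; u4; u5; t] <= A}.
Proof.
case=> _ /and5P[]; rewrite !inE /=.
move=> /and3P[_ A1 A2] /and3P[_ _ A3] /and3P[_ _ A4] /and3P[_ _ A5] _ /and3P[_ At _] _.
by apply/allP; rewrite /= A1 A2 A3 A4 A5 At.
Qed.

Definition house_in (A : {set V}) u1 u2 u3 u4 u5 t :=
  house (darts_in A) u1 u2 u3 u4 u5 t /\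
  all (fun u => #|[set w in A | G u w]| == 4) [:: u1; u2; u3; u4; u5; t].

Lemma exists_house (A : {set V}) : planar G -> A != set0 ->
  {in A, forall u, 4 <= #|[set w in A | G u w]|} ->
  exists u1 u2 u3 u4 u5 t, house_in A u1 u2 u3 u4 u5 t.
Proof.
move=> plG /set0Pn[u uA] deg4; set D := darts_in A.
have sD : simple D := simple_darts_in A.
have [n rn eu] : spherical D.
  apply: (spherical_sub (simple_darts G) sD) (spherical_planar plG).
  by apply/subsetP=> d; rewrite !inE => /and3P[].
have D0 : D != set0.
  have /card_gt0P[w] := leq_trans (ltn0Sn 3) (deg4 u uA); rewrite inE => /andP[wA uw].
  by apply/set0Pn; exists (u, w); rewrite inE /= uw uA wA.
apply: NNPP => nohouse; apply: (euler_deficit sD rn _ _ _ D0 eu).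
- by move=> d; rewrite inE => /and3P[_ dA _]; rewrite deg_in // deg4.
- move=> a b c e x; rewrite !inE /=.
  move=> /and3P[ab _ _] /and3P[bc _ _] /and3P[ce _ _] /and3P[ea _ _] ac be.
  move=> /and3P[xa _ _] /and3P[xb _ _].
  exact: (no_triangle_on_4cycle ab bc ce ea ac be xa xb).
move=> u1 u2 u3 u4 u5 t hs d4; apply: nohouse; exists u1, u2, u3, u4, u5, t; split=> //.
have inA := house_sub hs; apply/allP=> w wu; rewrite -deg_in.
  by move/allP: d4; apply.
exact: inA.
Qed.
End Structure.

Lemma card_outside (V : finType) (G : sgraph V) (A K : {set V}) u ks :
  uniq ks -> {subset ks <= [set w in A :&: K | G u w]} ->
  size ks + #|[set w in A :\: K | G u w]| <= #|[set w in A | G u w]|.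
Proof.
move=> Uks sub; rewrite -(card_uniqP Uks) -(cardsID K [set w in A | G u w]).
apply: leq_add; apply: subset_leq_card; apply/subsetP=> w.
  by move/sub; rewrite !inE => /andP[/andP[-> ->] ->].
by rewrite !inE => /andP[/andP[-> ->] ->].
Qed.

(** A vertex of degree at most 3 is coloured after all others. If there is none,
    the vertices of a house of 4-vertices are coloured last: their neighbours
    outside take away at most one unit of value each, and so every vertex of the
    house keeps at least as much value as it has neighbours in the house. *)
Lemma exists_colouring (V : finType) (G : sgraph V) (s : nat)
    (f : 'I_s -> V -> nat) (H : sgraph (V * 'I_s)%type) (A : {set V}) :
  planar G ->
  (forall c4 c3 : seq V, is_cycle G 4 c4 -> is_cycle G 3 c3 ->
     ~ adjacent_cycles c4 c3) ->
  (forall (i : 'I_s) (v : V), f i v <= 2) ->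
  (forall v : V, 4 <= \sum_(i < s) f i v) ->
  is_cover G H -> exists l, colouring H f A l.
Proof.
move=> plG noadj f_le2 f_ge4 coverH.
have [m] := ubnP #|A|; elim: m A => // m IH A /ltnSE mA.
have [->|A0] := eqVneq A set0.
  by exists [::]; split=> // v; rewrite inE.
have [/existsP[v /andP[vA degv]]|] :=
    boolP [exists v, (v \in A) && (#|[set w in A | G v w]| <= 3)].
  have lt : #|A :\ v| < #|A| by rewrite (cardsD1 v A) vA.
  have [l cl] := IH _ (leq_trans lt mA).
  have [||l' cl'] := colour_last coverH (v := v) cl; first by rewrite !inE eqxx.
    apply: leq_trans (f_ge4 v); rewrite ltnS (leq_trans _ degv) //.
    by apply: subset_leq_card; apply/subsetP=> w; rewrite !inE => /andP[/andP[_ ->] ->].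
  by exists l'; rewrite setD1K in cl'.
rewrite negb_exists => /forallP deg4.
have {}deg4 : {in A, forall u, 4 <= #|[set w in A | G u w]|}.
  by move=> u uA; have := deg4 u; rewrite uA /= -ltnNge.
have [u1 [u2 [u3 [u4 [u5 [t [hs /allP all4]]]]]]] := exists_house noadj plG A0 deg4.
have hol := house_is_hollow noadj hs; have inA := house_sub hs.
pose ks := [:: u1; u2; u3; u4; u5; t]; pose K := [set u in ks]; pose B := A :\: K.
have lt : #|B| < #|A|.
  apply: proper_card; apply/properP; split; first exact: subsetDl.
  by exists u1; [apply: inA | rewrite !inE]; rewrite ?inE eqxx.
have [l0 cl0] := IH _ (leq_trans lt mA).
have nB u : u \in ks -> u \notin B by rewrite !inE negb_and negbK => ->.
have value u nbs k : u \in ks -> uniq nbs -> k = size nbs ->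
    all (fun w => (w \in ks) && G u w) nbs -> k <= \sum_(i < s) residual H f l0 i u.
  move=> uks Un -> /allP nbsP; apply: (residual_sum coverH cl0 (nB u uks)).
  apply: leq_trans (f_ge4 u); rewrite -(eqP (all4 u uks)).
  apply: card_outside Un _ => w /nbsP/andP[wks uw].
  by rewrite inE uw andbT inE (inA w wks) inE.
case: (hs) => _ /and5P[]; rewrite !inE /=.
move=> /and3P[g12 _ _] /and3P[g23 _ _] /and3P[g34 _ _] /and3P[g45 _ _] /and3P[g51 _ _].
move=> /and3P[gt1 _ _] /and3P[gt2 _ _].
have [/and5P[n12 n13 n14 n15 n1t] /and4P[n23 n24 n25 n2t] /and3P[n34 n35 n3t]
  /andP[n45 n4t] n5t] := hollow_neq hol.
have r_le2 i v : residual H f l0 i v <= 2 := leq_trans (leq_subr _ _) (f_le2 i v).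
have sym u v : G u v -> G v u by rewrite adj_sym.
have [g21 g32 g43] := And3 (sym _ _ g12) (sym _ _ g23) (sym _ _ g34).
have [g54 g15 g1t g2t] := And4 (sym _ _ g45) (sym _ _ g51) (sym _ _ gt1) (sym _ _ gt2).
have [||||||l gl pl] := colour_house coverH hol r_le2.
- apply: (value u1 [:: u2; u5; t]) => //; rewrite /= !inE ?eqxx ?orbT //=.
    by rewrite negb_or n25 n2t n5t.
  by rewrite g12 g15 g1t.
- apply: (value u2 [:: u1; u3; t]) => //; rewrite /= !inE ?eqxx ?orbT //=.
    by rewrite negb_or n13 n1t n3t.
  by rewrite g23 g21 g2t.
- apply: (value u3 [:: u2; u4]) => //; rewrite /= !inE ?eqxx ?orbT ?n24 //=.
  by rewrite g32 g34.
- apply: (value u4 [:: u3; u5]) => //; rewrite /= !inE ?eqxx ?orbT ?n35 //=.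
  by rewrite g43 g45.
- apply: (value u5 [:: u4; u1]) => //; rewrite /= !inE ?eqxx ?orbT //=.
    by rewrite eq_sym n14.
  by rewrite g54 g51.
- apply: (value t [:: u1; u2]) => //; rewrite /= !inE ?eqxx ?orbT ?n12 //=.
  by rewrite gt1 gt2.
case: cl0 => Ul0 gl0 El0; exists (l ++ l0); split.
- rewrite /unzip1 map_cat cat_uniq (perm_uniq pl) Ul0 andbT.
  case/andP: hol => -> _ /=; apply/hasPn=> u; rewrite El0 => uB.
  by rewrite (perm_mem pl); apply: contraL uB => /nB.
- exact: greedy_cat.
move=> u; rewrite /unzip1 map_cat mem_cat El0 in_setD [u \in K]in_set (perm_mem pl) -/ks.
by case uks: (u \in ks) => //=; rewrite (inA u uks).
Qed.

Theorem theorem2p4 (V : finType) (G : sgraph V) (s : nat)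
    (f : 'I_s -> V -> nat) :
  planar G ->
  (forall c4 c3 : seq V, is_cycle G 4 c4 -> is_cycle G 3 c3 ->
     ~ adjacent_cycles c4 c3) ->
  2 <= s ->
  (forall (i : 'I_s) (v : V), f i v <= 2) ->
  (forall v : V, 4 <= \sum_(i < s) f i v) ->
  DP_colorable G f.
Proof.
move=> plG noadj _ f_le2 f_ge4 H coverH.
have [l /colouring_rep[repR sdR]] :=
  exists_colouring [set: V] plG noadj f_le2 f_ge4 coverH.
by exists [set p in l].
Qed.
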